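(* Let $m_3(s) = f_0 + g^T s + \frac12 H[s]^2 + \frac16 T[s]^3 + \frac{\sigma}{4}\|s\|_W^4$ on $\mathbb{R}^n$, let $m_{\mathrm{low}}$ be a lower bound on $m_3(s)$ over $s\in\mathbb{R}^n$, and let the Diagonal Tensor Algorithm described in the context be applied to $m_3$ with tolerance $\epsilon$. Suppose that the diagonal entries are uniformly bounded: $\max_{i,\,1\le j\le n}|t_j^{(i)}|\,[\lambda_{\min}(W)]^{-3/2}\le\hat B$. Then there exist positive constants $\kappa_s,\kappa_c$, independent of $\epsilon$, such that the algorithm requires at most $$\kappa_s\frac{m_3(s^{(0)})-m_{\mathrm{low}}}{\epsilon^{3/2}}+\kappa_c+\log\epsilon^{-1/2}=\mathcal{O}(\epsilon^{-3/2})$$ function evaluations (evaluations of $m_3$) and at most $$\kappa_s\frac{m_3(s^{(0)})-m_{\mathrm{low}}}{\epsilon^{3/2}}+1=\mathcal{O}(\epsilon^{-3/2})$$ derivative evaluations (evaluations of $g_i,H_i,T_i$) to compute an iterate $s_\epsilon$ with $\|\nabla m_3(s_\epsilon)\|\le\epsilon$ (that is, until $\|g_i\|\le\epsilon$ or $\|g_{i+1}\|\le\epsilon$).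
   Context: Setting: $f_0\in\mathbb{R}$, $g\in\mathbb{R}^n$, $H$ symmetric $n\times n$, $T$ a symmetric third-order tensor, $\sigma>0$, $W$ symmetric positive definite, $\|v\|_W=\sqrt{v^TWv}$, $\|\cdot\|$ Euclidean; $T[s]^3=\sum_{i,j,k}T_{ijk}s_is_js_k$; $\lambda_{\min}$ is the smallest eigenvalue. Diagonal tensor model: at an iterate $s^{(i)}$ write $f_i=m_3(s^{(i)})$, $g_i=\nabla m_3(s^{(i)})$, $H_i=\nabla^2m_3(s^{(i)})$, $T_i=\nabla^3m_3(s^{(i)})$. For a diagonal tensor $\mathcal{T}_i$ with diagonal entries $t_1^{(i)},\dots,t_n^{(i)}$ (so $\mathcal{T}_i[s]^3=\sum_jt_j^{(i)}s_j^3$) and $d_i\ge0$, set $\sigma_d^{(i)}=\sigma+d_i$ and $$M_d(s^{(i)},s)=f_i+g_i^Ts+\tfrac12s^TH_is+\tfrac16\mathcal{T}_i[s]^3+\tfrac14\sigma_d^{(i)}\|s\|_W^4 .$$ Algorithm. Fixed parameters: $\hat B>0$, $\alpha\in(0,\frac12)$, $\eta\in(0,1]$, $\gamma>1$, $\epsilon>0$ (small). Initialize $s^{(0)}=0$, $d_0=0$, $i=0$. Step 1: if $\|g_i\|\le\epsilon$, terminate with $s_\epsilon=s^{(i)}$. Step 2: compute a global minimizer $s_d^{(i)}\in\arg\min_{s\in\mathbb{R}^n}M_d(s^{(i)},s)$. Step 3: compute $m_3(s^{(i)}+s_d^{(i)})$ and $$\rho_i=\frac{m_3(s^{(i)})-m_3(s^{(i)}+s_d^{(i)})}{m_3(s^{(i)})-M_d(s^{(i)},s_d^{(i)})}.$$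 Step 4: if $\|\nabla m_3(s^{(i)}+s_d^{(i)})\|\le\epsilon$, terminate with $s_\epsilon=s^{(i)}+s_d^{(i)}$. Otherwise let $\beta_i=\mathcal{T}_i\big[s_d^{(i)}/\|s_d^{(i)}\|_W\big]^3$. The step is successful if $\rho_i\ge\eta$ and one of the following holds: (a) $\beta_i\ge\alpha$; (b) $\beta_i\le-4\alpha$ and $\sigma_d^{(i)}\notin[\frac16,\frac23]\,(-\beta_i+\alpha)\|s_d^{(i)}\|_W^{-1}$; (c) $\beta_i\in[-4\alpha,\alpha]$ and $\sigma_d^{(i)}\ge\frac23(-\beta_i+\alpha)\|s_d^{(i)}\|_W^{-1}$. Here $[\frac16,\frac23]\,c$ denotes the interval $[\frac c6,\frac{2c}3]$. In a successful step set $s^{(i+1)}=s^{(i)}+s_d^{(i)}$, choose $d_{i+1}$ with $0\le d_{i+1}\le d_i$, and update $g_{i+1},H_{i+1}$ and the diagonal tensor $\mathcal{T}_{i+1}$. Otherwise the step is unsuccessful: set $s^{(i+1)}=s^{(i)}$, keep $g_i,H_i,\mathcal{T}_i$ unchanged and set $d_{i+1}=\gamma\max\{1,d_i\}$. Increase $i$ by one and repeat from Step 1. Choice of $\mathcal{T}_i$: by the diagonal rule, $t_j^{(i)}$ is the $(j,j,j)$ entry of $T_i$, truncated in absolute value so that the bound by $\hat B$ holds; or by the low-rank rule, one takes a rank-$P$ approximation $\sum_{k=1}^P\boldsymbol{a}^{(k)}\otimes\boldsymbol{a}^{(k)}\otimes\boldsymbol{a}^{(k)}$ of $T_i$, completes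 the rows $(\boldsymbol{a}^{(k)})^T$ by vectors orthogonal to them to an invertible matrix $C$, uses the model data $C^{-T}g_i$, $C^{-T}H_iC^{-1}$, $C^{-T}WC^{-1}$ and the diagonal tensor with $P$ diagonal entries equal to $1$ and the rest $0$, and maps the model minimizer back by $C^{-1}$.
   Formalization: The tolerance is taken as ε ≤ 1, since the function-evaluation bound turns negative for large ε; in the low-rank rule the uniform bound on the diagonal entries uses λ_min(C^{-T}WC^{-1}) instead of λ_min(W), as otherwise the vectors a^(k) are unbounded and the claim fails. *)

(* Defs.v *)
From HB Require Import structures.
From mathcomp Require Import all_boot all_order all_algebra.
From mathcomp Require Import all_classical all_reals all_analysis.
Set Implicit Arguments.
Unset Strict Implicit.
Unset Printing Implicit Defensive.
Import Order.TTheory GRing.Theory Num.Theory.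
Import numFieldNormedType.Exports.
Local Open Scope classical_set_scope.
Local Open Scope ring_scope.

Section LinearAlgebra.
Context {R : realType} {n : nat}.

Definition dot (u v : 'cV[R]_n) : R := (u^T *m v) 0 0.

Definition quad (A : 'M[R]_n) (s : 'cV[R]_n) : R := (s^T *m A *m s) 0 0.

Definition norm2 (v : 'cV[R]_n) : R := Num.sqrt (dot v v).

Definition normW (W : 'M[R]_n) (v : 'cV[R]_n) : R := Num.sqrt (quad W v).

Definition symmetric_mx (A : 'M[R]_n) : Prop := A^T = A.

Definition pos_def (A : 'M[R]_n) : Prop := forall v, v != 0 -> 0 < quad A v.

(* For a symmetric real matrix with n >= 1 this set is finite and nonempty,
   so the infimum is the smallest eigenvalue. *)
Definition lambda_min (A : 'M[R]_n) : R := inf [set a : R | eigenvalue A a].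

Definition tensor3 := 'I_n -> 'I_n -> 'I_n -> R.

Definition symmetric_tensor (T : tensor3) : Prop :=
  forall i j k, T i j k = T j i k /\ T i j k = T i k j.

Definition cubic (T : tensor3) (s : 'cV[R]_n) : R :=
  \sum_i \sum_j \sum_k T i j k * s i 0 * s j 0 * s k 0.

Definition diag_tensor (t : 'I_n -> R) : tensor3 :=
  fun i j k => if (i == j) && (j == k) then t i else 0.

Definition basis_vec (i : 'I_n) : 'cV[R]_n := delta_mx i 0.

Definition partial (i : 'I_n) (m : 'cV[R]_n -> R) : 'cV[R]_n -> R :=
  fun s => 'D_(basis_vec i) (m : 'cV[R]_n -> R^o) s.

Definition grad (m : 'cV[R]_n -> R) (s : 'cV[R]_n) : 'cV[R]_n :=
  \col_i partial i m s.

Definition hess (m : 'cV[R]_n -> R) (s : 'cV[R]_n) : 'M[R]_n :=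
  \matrix_(i, j) partial i (partial j m) s.

Definition third (m : 'cV[R]_n -> R) (s : 'cV[R]_n) : tensor3 :=
  fun i j k => partial i (partial j (partial k m)) s.

(* f + g^T s + H[s]^2 / 2 + T[s]^3 / 6 + (sigma / 4) ||s||_W^4 *)
Definition ar3_model (f : R) (g : 'cV[R]_n) (H : 'M[R]_n) (T : tensor3)
    (sigma : R) (W : 'M[R]_n) (s : 'cV[R]_n) : R :=
  f + dot g s + 1 / 2 * quad H s + 1 / 6 * cubic T s
    + sigma / 4 * normW W s ^+ 4.

End LinearAlgebra.

Arguments tensor3 R n : clear implicits.

Section DiagonalTensorAlgorithm.
Context {R : realType} {n : nat}.

(* The state of one pass through the loop.  The model is built and minimized in
   the coordinates hat s = C s; the diagonal rule has C = 1. *)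
Record iterate := Iterate {
  it_s : 'cV[R]_n ;       (* s^(i) *)
  it_d : R ;              (* d_i *)
  it_C : 'M[R]_n ;        (* change of coordinates C *)
  it_t : 'I_n -> R ;      (* diagonal entries of the diagonal tensor *)
  it_hat : 'cV[R]_n       (* model minimizer, in the coordinates C s *)
}.

Context (m : 'cV[R]_n -> R) (sigma : R) (W : 'M[R]_n).
Context (B alpha eta gamma eps : R).

Definition model_g (x : iterate) : 'cV[R]_n :=
  (invmx (it_C x))^T *m grad m (it_s x).

Definition model_H (x : iterate) : 'M[R]_n :=
  (invmx (it_C x))^T *m hess m (it_s x) *m invmx (it_C x).

Definition model_W (x : iterate) : 'M[R]_n :=
  (invmx (it_C x))^T *m W *m invmx (it_C x).

Definition sigma_d (x : iterate) : R := sigma + it_d x.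

Definition model (x : iterate) : 'cV[R]_n -> R :=
  ar3_model (m (it_s x)) (model_g x) (model_H x) (diag_tensor (it_t x))
    (sigma_d x) (model_W x).

Definition model_argmin (x : iterate) : Prop :=
  forall s, model x (it_hat x) <= model x s.

Definition step (x : iterate) : 'cV[R]_n := invmx (it_C x) *m it_hat x.

Definition trial (x : iterate) : 'cV[R]_n := it_s x + step x.

(* Since C^{-T} W C^{-1} is the weight of the model, this equals ||step x||_W
   (C being invertible). *)
Definition step_norm (x : iterate) : R := normW (model_W x) (it_hat x).

Definition rho (x : iterate) : R :=
  (m (it_s x) - m (trial x)) / (m (it_s x) - model x (it_hat x)).

Definition beta (x : iterate) : R :=
  cubic (diag_tensor (it_t x)) ((step_norm x)^-1 *: it_hat x).

Definition case_threshold (x : iterate) : R :=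
  (- beta x + alpha) * (step_norm x)^-1.

Definition successful (x : iterate) : bool :=
  (eta <= rho x) &&
  [|| alpha <= beta x,
      (beta x <= - (4 * alpha)) &&
      (sigma_d x \notin `[1 / 6 * case_threshold x, 2 / 3 * case_threshold x])
    | (beta x \in `[- (4 * alpha), alpha]) &&
      (2 / 3 * case_threshold x <= sigma_d x)].

Definition diagonal_rule (x : iterate) : Prop :=
  it_C x = 1%:M /\
  let b := B * lambda_min W `^ (3 / 2) in
  forall j, it_t x j = Num.max (- b) (Num.min b (third m (it_s x) j j j)).

(* No accuracy is required of the approximation of third m (it_s x) by the sum
   of the cubes a k (x) a k (x) a k. *)
Definition low_rank_rule (x : iterate) : Prop :=
  exists P : nat, exists a : 'I_P -> 'cV[R]_n,
    [/\ (P <= n)%N,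
        it_C x \in unitmx,
        forall (k : 'I_P) (j : 'I_n), j = k :> nat -> row j (it_C x) = (a k)^T,
        forall (k : 'I_P) (j : 'I_n),
          (P <= j)%N -> dot (row j (it_C x))^T (a k) = 0
      & forall j : 'I_n, it_t x j = if (j < P)%N then 1 else 0].

Definition tensor_rule (x : iterate) : Prop :=
  diagonal_rule x \/ low_rank_rule x.

Definition stop_start (x : iterate) : bool := norm2 (grad m (it_s x)) <= eps.

Definition stop_trial (x : iterate) : bool := norm2 (grad m (trial x)) <= eps.

Definition stop (x : iterate) : bool := stop_start x || stop_trial x.

Definition output (x : iterate) : 'cV[R]_n :=
  if stop_start x then it_s x else trial x.

(* C and t are part of the diagonal tensor, so they too are kept when the step
   is unsuccessful. *)
Definition update (x y : iterate) : Prop :=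
  if successful x then it_s y = trial x /\ 0 <= it_d y <= it_d x
  else [/\ it_s y = it_s x, it_d y = gamma * Num.max 1 (it_d x),
           it_C y = it_C x & it_t y = it_t x].

(* The algorithm has not terminated before the start of iteration i. *)
Definition reached (r : nat -> iterate) (i : nat) : Prop :=
  forall j, (j < i)%N -> ~~ stop (r j).

(* The entries of r after termination are unconstrained, and so is the
   minimizer stored in r i if the test on ||g_i|| ends the run. *)
Definition is_run (r : nat -> iterate) : Prop :=
  [/\ it_s (r 0%N) = 0,
      it_d (r 0%N) = 0
    & forall i, reached r i ->
        [/\ tensor_rule (r i),
            ~~ stop_start (r i) -> model_argmin (r i)
          & ~~ stop (r i) -> update (r i) (r i.+1)]].

Definition tensors_bounded (r : nat -> iterate) : Prop :=
  forall i, reached r i -> forall j : 'I_n,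
    `|it_t (r i) j| * lambda_min (model_W (r i)) `^ (- (3 / 2)) <= B.

Definition terminates_at (r : nat -> iterate) (k : nat) : Prop :=
  reached r k /\ stop (r k).

(* Evaluations of m when the run ends in iteration k: m(s^(0)), and one at the
   trial point of each iteration that does not end with the test on ||g_i||. *)
Definition function_evals (r : nat -> iterate) (k : nat) : nat :=
  1 + k + ~~ stop_start (r k).

(* Evaluations of (g_i, H_i, T_i): at s^(0) and after each successful step. *)
Definition derivative_evals (r : nat -> iterate) (k : nat) : nat :=
  1 + \sum_(j < k) successful (r j).

End DiagonalTensorAlgorithm.

Arguments iterate R n : clear implicits.

(* Main.v *)
(** Write [h] for the square root of [eps].  Optimality of the global minimizer
    [s] of the model gives a gradient of norm [O(||s||^2 + d ||s||^3)] at the trial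
    point, a decrease of order [||s||^3] in a successful step, and success as soon
    as [d ||s||] is large.  Hence [d = O(1/h)], and a successful step that leaves a
    gradient of norm [G > eps] decreases [m3] by at least a multiple of
    [G h >= h^3], which bounds the number of derivative evaluations.

    Since [d] may be reset to 0 after a success, up to [log (1/h)] failures can
    precede each success, so [h^-3] successes would not be good enough.  But [m3]
    is a fixed polynomial, and there are only [O(h^-2)] successes.  Those with
    [G > h] decrease [m3] by a multiple of [h^2].  The others produce values of [m3],
    [h^3] apart, at points of a bounded set where the gradient is at most [h].  By
    quantifier elimination one can select such a point for each value so that
    each coordinate crosses each level a bounded number of times; as the gradient is
    small, two of these values that are [h^3] apart force a jump of order [h^2] of
    the selection, and there are [O(h^-2)] such jumps.  With [O(1/h)] failures per
    success, the number of iterations is [O(h^-3)]. *)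

Require Import Defs.
From mathcomp Require Import all_boot all_order all_algebra.
From mathcomp Require Import all_classical all_reals all_analysis.
From mathcomp Require Import ring lra zify.
From mathcomp.real_closed Require polyrcf ordered_qelim qe_rcf.
Import Order.TTheory GRing.Theory Num.Theory.
Import numFieldNormedType.Exports.
Local Open Scope classical_set_scope.
Local Open Scope ring_scope.
Set Implicit Arguments.
Unset Strict Implicit.
Unset Printing Implicit Defensive.

(** Along the ray through its global minimizer the model is a quartic. With [N] the length of the
    step, [y = sigma_d * N] and [b] the value of [beta], minimality on that ray gives a model
    decrease of at least [N ^+ 3 * (3 * y + b) ^+ 2 / (36 * y)]. It degenerates only near
    [y = - b / 3], which the three acceptance cases avoid.

    In a failed step [d * N] is bounded, and a gradient above [h ^+ 2] then forces [N] to be at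
    least a multiple of [h]; this is how [d = O(1/h)] arises.

    Points visited by the algorithm need not be close to one another when their values are, so the
    values cannot be counted through the points themselves. Each point is replaced by the
    lexicographically least one with the same value, a gradient of norm at most [h] and bounded
    length. A formula describes this choice with the value and the gradient bound as free variables,
    so the number of crossings is bounded independently of [h]. *)

Module ord := ordered_qelim.ord.

(** * Definable sets *)

Section Definability.
Variable R : realType.
Implicit Types (F G : (nat -> R) -> R) (P Q : (nat -> R) -> Prop).

(** Formulas are evaluated on finite sequences, so the equation is demanded only on environments
    that vanish from some index on. [rterm] excludes inverses, which makes [F] a polynomial
    there. *)
Definition polyfun F := exists2 t : GRing.term R, GRing.rterm t &
  forall e : seq R, GRing.eval e t = F (fun i => nth 0 e i).

Definition definable P := exists f : ord.formula R,
  forall e : seq R, ord.holds e f <-> P (fun i => nth 0 e i).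

Definition upd (e : nat -> R) k x : nat -> R :=
  fun i => if i == k then x else e i.

Lemma nth_upd (e : seq R) k x :
  (fun i => nth 0 (set_nth 0 e k x) i) = upd (fun i => nth 0 e i) k x.
Proof. by apply/funext => i; rewrite nth_set_nth. Qed.

Lemma polyfun_var i : polyfun (fun e => e i).
Proof. by exists (GRing.Var R i). Qed.

Lemma polyfun_const c : polyfun (fun=> c).
Proof. by exists (GRing.Const c). Qed.

Lemma polyfunD F G : polyfun F -> polyfun G -> polyfun (fun e => F e + G e).
Proof.
move=> [t rt tE] [u ru uE]; exists (GRing.Add t u) => [|e] /=.
  by rewrite rt.
by rewrite tE uE.
Qed.

Lemma polyfunM F G : polyfun F -> polyfun G -> polyfun (fun e => F e * G e).
Proof.
move=> [t rt tE] [u ru uE]; exists (GRing.Mul t u) => [|e] /=.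
  by rewrite rt.
by rewrite tE uE.
Qed.

Lemma polyfunX F k : polyfun F -> polyfun (fun e => F e ^+ k).
Proof.
move=> [t rt tE]; exists (GRing.Exp t k) => // e /=.
by rewrite tE.
Qed.

Lemma polyfun_sum (I : finType) (F : I -> (nat -> R) -> R) :
  (forall i, polyfun (F i)) -> polyfun (fun e => \sum_i F i e).
Proof.
move=> Fp; have : forall s : seq I, polyfun (fun e => \sum_(i <- s) F i e).
  elim=> [|i s IH].
    have := polyfun_const 0; congr polyfun; apply/funext => e.
    by rewrite big_nil.
  have := polyfunD (Fp i) IH; congr polyfun; apply/funext => e.
  by rewrite big_cons.
by move=> /(_ (index_enum I)).
Qed.

Lemma polyfun_continuous F m : polyfun F ->
  continuous (fun u : 'rV[R]_m => F (fun i => oapp (u 0) 0 (insub i))).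
Proof.
move=> [t rt tE].
pose sq (u : 'rV[R]_m) := [seq oapp (u 0) 0 (insub i) | i <- iota 0 m].
have sqE u i : nth 0 (sq u) i = oapp (u 0) 0 (insub i).
  have [im|mi] := ltnP i m.
    by rewrite (nth_map 0) ?size_iota// nth_iota.
  by rewrite nth_default ?size_map ?size_iota// insubN -?leqNgt.
have -> : (fun u : 'rV[R]_m => F (fun i => oapp (u 0) 0 (insub i))) =
    (fun u => GRing.eval (sq u) t).
  apply/funext => u; rewrite tE; congr F; apply/funext => i.
  by rewrite sqE.
elim: t rt {tE} => //=.
- move=> i _; under eq_fun do rewrite sqE.
  case: insubP => [j _ _|_] /=; first exact: coord_continuous.
  by move=> u; apply: cst_continuous.
- by move=> c _ u; apply: cst_continuous.
- by move=> c _ u; apply: cst_continuous.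
- move=> t1 IH1 t2 IH2 /andP[/IH1 c1 /IH2 c2] u.
  exact: cvgD (c1 u) (c2 u).
- by move=> t1 IH1 /IH1 c1 u; exact: cvgN (c1 u).
- move=> t1 IH1 k /IH1 c1 u.
  exact: cvgMn (c1 u).
- move=> t1 IH1 t2 IH2 /andP[/IH1 c1 /IH2 c2] u.
  exact: cvgM (c1 u) (c2 u).
- move=> t1 IH1 k /IH1 c1 u.
  apply: (@continuous_comp _ _ _ (fun u => GRing.eval (sq u) t1) (fun x => x ^+ k) u (c1 u) (@exprn_continuous R k _)).
Qed.

Lemma definable_ext P Q : (forall e, P e <-> Q e) -> definable P -> definable Q.
Proof. by move=> PQ [f fP]; exists f => e; rewrite fP. Qed.

Lemma definable_le F G : polyfun F -> polyfun G -> definable (fun e => F e <= G e).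
Proof.
by move=> [t _ tE] [u _ uE]; exists (ord.Le t u) => e /=; rewrite tE uE.
Qed.

Lemma definable_lt F G : polyfun F -> polyfun G -> definable (fun e => F e < G e).
Proof.
by move=> [t _ tE] [u _ uE]; exists (ord.Lt t u) => e /=; rewrite tE uE.
Qed.

Lemma definable_eq F G : polyfun F -> polyfun G -> definable (fun e => F e = G e).
Proof.
by move=> [t _ tE] [u _ uE]; exists (ord.Equal t u) => e /=; rewrite tE uE.
Qed.

Lemma definable_true : definable (fun=> True).
Proof. by exists (ord.Bool true). Qed.

Lemma definable_false : definable (fun=> False).
Proof. by exists (ord.Bool false). Qed.

Lemma definable_and P Q : definable P -> definable Q ->
  definable (fun e => P e /\ Q e).
Proof. by move=> [f fP] [g gQ]; exists (ord.And f g) => e /=; rewrite fP gQ. Qed.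

Lemma definable_or P Q : definable P -> definable Q ->
  definable (fun e => P e \/ Q e).
Proof. by move=> [f fP] [g gQ]; exists (ord.Or f g) => e /=; rewrite fP gQ. Qed.

Lemma definable_imply P Q : definable P -> definable Q ->
  definable (fun e => P e -> Q e).
Proof.
move=> [f fP] [g gQ]; exists (ord.Implies f g) => e /=.
by rewrite fP gQ.
Qed.

Lemma definable_exists P k : definable P ->
  definable (fun e => exists x, P (upd e k x)).
Proof.
move=> [f fP]; exists (ord.Exists k f) => e /=.
by split=> -[x Hx]; exists x; move: Hx; rewrite fP nth_upd.
Qed.

Lemma definable_forall P k : definable P ->
  definable (fun e => forall x, P (upd e k x)).
Proof.
move=> [f fP]; exists (ord.Forall k f) => e /=.
by split=> H x; move: (H x); rewrite fP nth_upd.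
Qed.

Definition upd_block (e : nat -> R) k m (x : nat -> R) : nat -> R :=
  fun i => if (k <= i < k + m)%N then x (i - k)%N else e i.

Lemma upd_block_upd e k m x : upd_block e k m.+1 x = upd_block (upd e (k + m) (x m)) k m x.
Proof.
apply/funext => i; rewrite /upd_block /upd addnS ltnS.
have [ki|ik] := leqP k i; last by rewrite ltn_eqF//= ltn_addr.
rewrite /=; have [|im] := ltnP i (k + m); first by move/ltnW ->.
rewrite leq_eqVlt ltnNge im orbF; case: eqP => // ->.
by rewrite addKn.
Qed.

Lemma upd_block_eq e k m x y : (forall i, (i < m)%N -> x i = y i) ->
  upd_block e k m x = upd_block e k m y.
Proof.
move=> xy; apply/funext => i; rewrite /upd_block; case: ifP => // /andP[ki ikm].
by apply: xy; rewrite ltn_subLR.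
Qed.

Lemma definable_exists_block P k m : definable P ->
  definable (fun e => exists x, P (upd_block e k m x)).
Proof.
elim: m P => [|m IH] P dP.
  apply: definable_ext dP => e; have b0 x : upd_block e k 0 x = e.
    by apply/funext => i; rewrite /upd_block addn0; case: ltngtP.
  by split=> [Pe|[x]]; [exists (fun=> 0)|]; rewrite b0.
apply: definable_ext (definable_exists (k + m) (IH P dP)) => e; split.
  move=> [y [x Px]]; exists (upd x m y); move: Px.
  rewrite upd_block_upd {3}/upd eqxx; congr P; apply: upd_block_eq => i im.
  by rewrite /upd ltn_eqF.
by move=> [x]; rewrite upd_block_upd => Px; exists (x m), x.
Qed.

Lemma definable_forall_block P k m : definable P ->
  definable (fun e => forall x, P (upd_block e k m x)).
Proof.
elim: m P => [|m IH] P dP.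
  apply: definable_ext dP => e; have b0 x : upd_block e k 0 x = e.
    by apply/funext => i; rewrite /upd_block addn0; case: ltngtP.
  by split=> [Pe x|/(_ (fun=> 0))]; rewrite b0.
apply: definable_ext (definable_forall (k + m) (IH P dP)) => e; split.
  by move=> H x; rewrite upd_block_upd; exact: H.
move=> H y x; have := H (upd x m y).
rewrite upd_block_upd {2}/upd eqxx; congr P; apply: upd_block_eq => i im.
by rewrite /upd ltn_eqF.
Qed.

(** With the other variables fixed, a term is a polynomial in variable [k] whose size is bounded by
    the syntax alone. [M] stands before [e] because every later count inherits this uniformity. *)
Lemma rterm_poly (t : GRing.term R) k : GRing.rterm t ->
  exists M, forall e : seq R, exists2 p : {poly R}, (size p <= M)%N &
    forall x, p.[x] = GRing.eval (set_nth 0 e k x) t.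
Proof.
elim: t => //=.
- move=> i _; exists 2%N => e; have [->|ik] := eqVneq i k.
    by exists 'X => [|x]; rewrite ?size_polyX// hornerX nth_set_nth/= eqxx.
  exists (nth 0 e i)%:P => [|x]; first by rewrite (leq_trans (size_polyC_leq1 _)).
  by rewrite hornerC nth_set_nth /= (negPf ik).
- move=> c _; exists 1%N => e; exists c%:P => [|x]; rewrite ?hornerC//.
  exact: size_polyC_leq1.
- move=> c _; exists 1%N => e; exists c%:R%:P => [|x]; rewrite ?hornerC//.
  exact: size_polyC_leq1.
- move=> t1 IH1 t2 IH2 /andP[/IH1[M1 H1] /IH2[M2 H2]].
  exists (maxn M1 M2) => e; have [p1 s1 E1] := H1 e; have [p2 s2 E2] := H2 e.
  exists (p1 + p2) => [|x]; last by rewrite hornerD E1 E2.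
  rewrite (leq_trans (size_polyD _ _))// geq_max !leq_max s1 s2 orbT.
  by [].
- move=> t1 IH1 /IH1[M1 H1]; exists M1 => e; have [p1 s1 E1] := H1 e.
  by exists (- p1) => [|x]; rewrite ?size_polyN// hornerN E1.
- move=> t1 IH1 m /IH1[M1 H1]; exists M1 => e; have [p1 s1 E1] := H1 e.
  exists (p1 *+ m) => [|x]; last by rewrite hornerMn E1.
  by rewrite -scaler_nat (leq_trans (size_scale_leq _ _)).
- move=> t1 IH1 t2 IH2 /andP[/IH1[M1 H1] /IH2[M2 H2]].
  exists (M1 + M2)%N => e; have [p1 s1 E1] := H1 e; have [p2 s2 E2] := H2 e.
  exists (p1 * p2) => [|x]; last by rewrite hornerM E1 E2.
  rewrite (leq_trans (size_polyMleq _ _))// (leq_trans (leq_pred _))//.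
  exact: leq_add.
- move=> t1 IH1 m /IH1[M1 H1]; exists (M1 * m).+1 => e; have [p1 s1 E1] := H1 e.
  exists (p1 ^+ m) => [|x]; last by rewrite horner_exp E1.
  rewrite (leq_trans (size_poly_exp_leq _ _))// ltnS leq_mul2r.
  by rewrite (leq_trans (leq_pred _))// orbT.
Qed.

(** A duplicate-free list of roots of maximal length contains all of them, as a missing root could
    be added to it. *)
Lemma roots_seq (p : {poly R}) : p != 0 ->
  exists2 s : seq R, (size s <= size p)%N & forall x, root p x -> x \in s.
Proof.
move=> p0.
have [s [us ps sz]] : exists s : seq R, [/\ uniq s, all (root p) s &
    forall t, uniq t -> all (root p) t -> (size t <= size s)%N].
  have bnd : forall t : seq R, uniq t -> all (root p) t -> (size t < size p)%N.
    by move=> t ut pt; apply: max_poly_roots.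
  pose Q k := `[< exists s : seq R, [/\ uniq s, all (root p) s & size s = k] >].
  have Q0 : exists k, Q k by exists 0%N; apply/asboolP; exists [::].
  have Qb k : Q k -> (k <= size p)%N.
    by move=> /asboolP[s [us ps <-]]; rewrite ltnW// bnd.
  case: (ex_maxnP Q0 Qb) => k /asboolP[s [us ps <-]] kmax.
  by exists s; split=> // t ut pt; apply: kmax; apply/asboolP; exists t.
exists s => [|x px]; first by rewrite ltnW// max_poly_roots.
apply/negPn/negP => xs; have := sz (x :: s).
by rewrite /= xs us px ps ltnn => /(_ isT isT).
Qed.

(** The break points are the roots: on an interval that avoids them the intermediate value theorem
    keeps the sign. The zero polynomial has constant sign and gets no break points. *)
Lemma rterm_sign (t : GRing.term R) k : GRing.rterm t ->
  exists M, forall e : seq R, exists2 s : seq R, (size s <= M)%N &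
    forall a b, a <= b -> (forall c, c \in s -> ~~ (a <= c <= b)) ->
      Num.sg (GRing.eval (set_nth 0 e k a) t) =
      Num.sg (GRing.eval (set_nth 0 e k b) t).
Proof.
move=> /(rterm_poly k)[M HM]; exists M => e; have [p pM pE] := HM e.
have [p0|p0] := eqVneq p 0.
  by exists [::] => // a b _ _; rewrite -!pE p0 !horner0.
have [s sp sr] := roots_seq p0; exists s => [|a b ab nos].
  exact: leq_trans sp pM.
rewrite -!pE.
have nr c : a <= c <= b -> p.[c] != 0.
  by move=> acb; apply/negP => /sr/nos; rewrite acb.
have pa := nr a; have pb := nr b; rewrite lexx ab in pa; rewrite lexx ab in pb.
have {}pa := pa isT; have {}pb := pb isT.
have pab : 0 < p.[a] * p.[b].
  rewrite ltNge; apply/negP => /(polyrcf.poly_ivt ab)[x].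
  by rewrite in_itv/= => /nr /negP px /eqP /eqP.
case: (ltgtP p.[a] 0) pa => // pa _.
  by move: pab; rewrite nmulr_rgt0// => pb'; rewrite !ltr0_sg.
by move: pab; rewrite pmulr_rgt0// => pb'; rewrite !gtr0_sg.
Qed.

(** The truth of an atom depends on the sign of the difference of two terms; a binary connective
    concatenates the break points of its two sides, and the bounds add up. *)
Lemma qf_finite (f : ord.formula R) k : ord.qf_form f && ord.rformula f ->
  exists M, forall e : seq R, exists2 s : seq R, (size s <= M)%N &
    forall a b, a <= b -> (forall c, c \in s -> ~~ (a <= c <= b)) ->
      ord.qf_eval (set_nth 0 e k a) f = ord.qf_eval (set_nth 0 e k b) f.
Proof.
have cmp (t u : GRing.term R) : GRing.rterm t && GRing.rterm u ->
    exists M, forall e : seq R, exists2 s : seq R, (size s <= M)%N &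
    forall a b, a <= b -> (forall c, c \in s -> ~~ (a <= c <= b)) ->
      let d x := GRing.eval (set_nth 0 e k x) t - GRing.eval (set_nth 0 e k x) u in
      Num.sg (d a) = Num.sg (d b).
  move=> tu; have [|M HM] := @rterm_sign (GRing.Add t (GRing.Opp u)) k; first by [].
  by exists M => e; have [s sM sP] := HM e; exists s.
have bin (f1 f2 g : ord.formula R) (o : bool -> bool -> bool) :
    (forall e : seq R, ord.qf_eval e g = o (ord.qf_eval e f1) (ord.qf_eval e f2)) ->
    (exists M, forall e : seq R, exists2 s : seq R, (size s <= M)%N &
    forall a b, a <= b -> (forall c, c \in s -> ~~ (a <= c <= b)) ->
      ord.qf_eval (set_nth 0 e k a) f1 = ord.qf_eval (set_nth 0 e k b) f1) ->
    (exists M, forall e : seq R, exists2 s : seq R, (size s <= M)%N &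
    forall a b, a <= b -> (forall c, c \in s -> ~~ (a <= c <= b)) ->
      ord.qf_eval (set_nth 0 e k a) f2 = ord.qf_eval (set_nth 0 e k b) f2) ->
    exists M, forall e : seq R, exists2 s : seq R, (size s <= M)%N &
    forall a b, a <= b -> (forall c, c \in s -> ~~ (a <= c <= b)) ->
      ord.qf_eval (set_nth 0 e k a) g = ord.qf_eval (set_nth 0 e k b) g.
  move=> gE [M1 H1] [M2 H2]; exists (M1 + M2)%N => e.
  have [s1 z1 E1] := H1 e; have [s2 z2 E2] := H2 e.
  exists (s1 ++ s2) => [|a b ab nos]; first by rewrite size_cat leq_add.
  by rewrite !gE (E1 a b) ?(E2 a b)// => c cs; apply: nos; rewrite mem_cat cs ?orbT.
elim: f => //=.
- by move=> b _; exists 0%N => e; exists [::].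
- move=> t u /cmp[M HM]; exists M => e; have [s sM sP] := HM e; exists s => // a b ab nos.
  have := sP a b ab nos => /= E; rewrite -subr_eq0 -[RHS]subr_eq0.
  by rewrite -sgr_eq0 -[RHS]sgr_eq0 E.
- move=> t u /cmp[M HM]; exists M => e; have [s sM sP] := HM e; exists s => // a b ab nos.
  have := sP a b ab nos => /= E; rewrite -subr_lt0 -[RHS]subr_lt0.
  by rewrite -sgr_lt0 -[RHS]sgr_lt0 E.
- move=> t u /cmp[M HM]; exists M => e; have [s sM sP] := HM e; exists s => // a b ab nos.
  have := sP a b ab nos => /= E; rewrite -subr_le0 -[RHS]subr_le0.
  by rewrite -sgr_le0 -[RHS]sgr_le0 E.
- move=> f1 IH1 f2 IH2 /andP[/andP[q1 q2] /andP[r1 r2]].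
  by apply: (bin f1 f2 (ord.And f1 f2) andb) => //; [apply: IH1|apply: IH2]; rewrite ?q1 ?q2.
- move=> f1 IH1 f2 IH2 /andP[/andP[q1 q2] /andP[r1 r2]].
  by apply: (bin f1 f2 (ord.Or f1 f2) orb) => //; [apply: IH1|apply: IH2]; rewrite ?q1 ?q2.
- move=> f1 IH1 f2 IH2 /andP[/andP[q1 q2] /andP[r1 r2]].
  by apply: (bin f1 f2 (ord.Implies f1 f2) implb) => //; [apply: IH1|apply: IH2]; rewrite ?q1 ?q2.
- move=> f1 IH1 /IH1[M HM]; exists M => e; have [s sM sP] := HM e.
  by exists s => // a b ab nos; rewrite (sP a b).
Qed.

(* Quantifier elimination bounds the number of changes of the truth value
   uniformly in the other variables. *)
Lemma definable_finite P k : definable P ->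
  exists M, forall e : seq R, exists2 s : seq R, (size s <= M)%N &
    forall a b, a <= b -> (forall c, c \in s -> ~~ (a <= c <= b)) ->
      P (upd (fun i => nth 0 e i) k a) <-> P (upd (fun i => nth 0 e i) k b).
Proof.
move=> [f fP].
(* [to_rform] removes inverses first; the result of the elimination is quantifier-free and falls
   under [qf_finite]. *)
pose q := ord.quantifier_elim (fun i bc => qe_rcf.qfr_to_formula (@qe_rcf.wproj R i bc))
  (ord.to_rform f).
have qw : ord.qf_form q && ord.rformula q.
  exact: (ord.quantifier_elim_wf (@qe_rcf.wf_QE_wproj R) (ord.to_rform_rformula f)).
have qP e : reflect (P (fun i => nth 0 e i)) (ord.qf_eval e q).
  by apply: (iffP (@qe_rcf.rcf_satP R e f)); rewrite fP.
have [M HM] := qf_finite k qw; exists M => e; have [s sM sP] := HM e.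
exists s => // a b ab nos; have E := sP a b ab nos.
by rewrite -!nth_upd; split => /qP; [rewrite E|rewrite -E] => /qP.
Qed.

End Definability.

(** * Definable selections with few large jumps *)

Section Crossings.
Variable R : realType.
Implicit Types (P Q : (nat -> R) -> Prop).

Lemma definable_bexists (P : nat -> (nat -> R) -> Prop) m :
  (forall i, definable (P i)) -> definable (fun e => exists2 i, (i < m)%N & P i e).
Proof.
move=> dP; elim: m => [|m IH].
  by apply: definable_ext (definable_false R) => e; split=> // -[].
apply: definable_ext (definable_or IH (dP m)) => e; split.
  by move=> [[i im Pi]|Pm]; [exists i => //; exact: ltnW|exists m].
move=> [i]; rewrite ltnS leq_eqVlt => /predU1P[->|im] Pi; first by right.
by left; exists i.
Qed.

Lemma definable_bforall (P : nat -> (nat -> R) -> Prop) m :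
  (forall i, definable (P i)) -> definable (fun e => forall i, (i < m)%N -> P i e).
Proof.
move=> dP; elim: m => [|m IH].
  by apply: definable_ext (definable_true R) => e; split.
apply: definable_ext (definable_and IH (dP m)) => e; split.
  by move=> [H Pm] i; rewrite ltnS leq_eqVlt => /predU1P[->//|]; exact: H.
by move=> H; split=> [i im|]; apply: H => //; exact: ltnW.
Qed.

(** Intervals between consecutive values overlap only at end points. A passage is of at least one of
    the half-open kinds [q1] and [q2], and each kind occurs at most once. *)
Lemma passages_le2 (c : R) (v : nat -> R) N :
  (forall j, (j < N)%N -> v j.+1 < v j) ->
  (\sum_(j < N) (v j.+1 <= c <= v j)%R <= 2)%N.
Proof.
move=> dec.
(* Telescoping: [q] holds only where the monotone predicate [p] switches from false to true. *)
have tel (p q : nat -> bool) : (forall j, (j < N)%N -> (p j -> p j.+1)) ->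
    (forall j, (j < N)%N -> q j -> p j.+1 && ~~ p j) ->
    (\sum_(j < N) q j <= 1)%N.
  move=> pp qp; suff: (\sum_(j < N) q j + p 0 <= p N)%N.
    by case: (p N); lia.
  elim: N pp qp {dec} => [|N IH] pp qp; first by rewrite big_ord0.
  have {}IH := IH (fun j jN => pp j (ltnW jN)) (fun j jN => qp j (ltnW jN)).
  rewrite big_ord_recr /=; have := pp N (ltnSn N); have := qp N (ltnSn N).
  move: IH; case: (p N); case: (q N); case: (p N.+1) => /=; lia.
pose q1 j := v j.+1 <= c < v j; pose q2 j := v j.+1 < c <= v j.
have s1 : (\sum_(j < N) q1 j <= 1)%N.
  apply: (tel (fun j => v j <= c)) => j jN; rewrite /q1.
    by move=> vc; apply: le_trans vc; exact: ltW (dec j jN).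
  by move=> /andP[-> ]; rewrite ltNge.
have s2 : (\sum_(j < N) q2 j <= 1)%N.
  apply: (tel (fun j => v j < c)) => j jN; rewrite /q2.
    by move=> vc; apply: lt_trans vc; exact: (dec j jN).
  by move=> /andP[-> ]; rewrite leNgt.
apply: leq_trans (_ : \sum_(j < N) (q1 j + q2 j) <= _)%N; last first.
  by rewrite big_split /= (leq_add s1 s2).
apply: leq_sum => j _; rewrite /q1 /q2; have := dec j (ltn_ord j).
case: (ltgtP (v j.+1) c); case: (ltgtP c (v j)) => //= -> ->; by rewrite ltxx.
Qed.

(** A change of truth value between [v j] and [v j.+1] needs a break point in between, and each
    break point serves at most two values of [j]. *)
Lemma definable_crossings P (k : nat) : definable P ->
  exists M, forall (e : seq R) (v : nat -> R) N,
    (forall j, (j < N)%N -> v j.+1 < v j) ->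
    (\sum_(j < N) (`[< P (upd (fun i => nth 0%R e i) k (v j)) >] !=
                   `[< P (upd (fun i => nth 0%R e i) k (v j.+1)) >]) <= M)%N.
Proof.
move=> /(definable_finite k)[M HM]; exists (M * 2)%N => e v N dec.
have [s sM sP] := HM e.
apply: leq_trans (_ : \sum_(c <- s) \sum_(j < N) (v j.+1 <= c <= v j)%R <= _)%N.
  rewrite exchange_big /=; apply: leq_sum => j _.
  case: eqP => // PP; rewrite lt0n; apply/eqP => s0; apply: PP.
  apply/asbool_equiv_eq; apply: iff_sym.
  apply: sP => [|c cs]; first exact: ltW (dec j _).
  apply/negP => vc; have := s0; rewrite (big_rem _ cs) /= vc.
  by [].
apply: leq_trans (_ : \sum_(c <- s) 2 <= _)%N.
  by apply: leq_sum => c _; exact: passages_le2.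
by rewrite big_const_seq iter_addn_0 count_predT mulnC leq_mul2r sM.
Qed.

(** Points are environments with infinite tails, of which only the first [m] entries count; [agree]
    therefore takes the place of equality, also in the lexicographic order. *)
Definition agree m (x z : nat -> R) := forall i, (i < m)%N -> x i = z i.
Definition lexlt m (x z : nat -> R) :=
  exists2 i, (i < m)%N & agree i x z /\ x i < z i.
Definition lexle m (x z : nat -> R) := agree m x z \/ lexlt m x z.

Lemma lexle_anti m x z : lexle m x z -> lexle m z x -> agree m x z.
Proof.
move=> [//|[i im [xz xzi]]] [zx|[j jm [zx zxj]]].
  by move: xzi; rewrite zx// ltxx.
have [ij|ji|ij] := ltngtP i j.
- by move: xzi; rewrite zx// ltxx.
- by move: zxj; rewrite xz// ltxx.
- by move: xzi zxj; rewrite ij => /lt_trans h /h; rewrite ltxx.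
Qed.

Definition coords m (u : 'rV[R]_m) (i : nat) : R := oapp (u 0) 0 (insub i).

Lemma coords_ord m (u : 'rV[R]_m) (i : 'I_m) : coords u i = u 0 i.
Proof. by rewrite /coords valK. Qed.

(** The coordinates are minimized in turn. [B] holds the points of [A] that are least in the first
    [k] coordinates; it contains every point of [A] that ties with one of its own, so ties are
    decided by coordinate [k]. *)
Lemma lexmin_exists m (A : set 'rV[R]_m) : compact A -> A !=set0 ->
  exists2 u, A u & forall w, A w -> lexle m (coords u) (coords w).
Proof.
move=> cA A0.
suff K k : (k <= m)%N -> exists B : set 'rV[R]_m,
    [/\ B `<=` A, compact B, B !=set0,
     (forall u w, B u -> A w -> agree k (coords u) (coords w) -> B w) &
     (forall u w, B u -> A w -> lexle k (coords u) (coords w))].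
  have [B [BA cB [u Bu] _ H]] := K m (leqnn m).
  by exists u; [exact: BA|move=> w Aw; exact: H].
elim: k => [_|k IH km].
  by exists A; split=> // u w _ _; left.
have [B [BA cB B0 clB H]] := IH (ltnW km).
pose f (u : 'rV[R]_m) := u 0 (Ordinal km).
have cf : continuous f by exact: coord_continuous.
have fE u : f u = coords u k by rewrite -[k]/(val (Ordinal km)) coords_ord.
have [c /set_mem Bc cmin] := @compact_EVT_min _ _ f B B0 cB (continuous_subspaceT cf).
exists (B `&` [set u | f u <= f c]); split.
- by move=> u [Bu _]; exact: BA.
- apply: compact_closedI => //.
  rewrite -[X in closed X]/(f @^-1` [set x | x <= f c]).
  apply: closed_comp; [move=> u _; exact: cf|exact: closed_le].
- by exists c; split; [exact: Bc|exact: lexx].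
- move=> u w [Bu /= uc] Aw uw; split.
    by apply: clB Bu Aw _ => i ik; apply: uw; rewrite ltnS ltnW.
  by rewrite /= fE -uw// -fE.
- move=> u w [Bu /= uc] Aw; have [uw|[i ik Hi]] := H u w Bu Aw; last first.
    by right; exists i => //; exact: ltnW.
  have Bw := clB u w Bu Aw uw; have := le_trans uc (cmin w (mem_set Bw)).
  rewrite !fE le_eqVlt => /predU1P[E|lt].
    left => i; rewrite ltnS leq_eqVlt => /predU1P[->//|]; exact: uw.
  by right; exists k.
Qed.

(** The first grid point strictly beyond [a] is at most [a + d]. Its index is one more than a
    truncated quotient of at most [2 * L / d], hence the [.+2]. *)
Lemma grid_point (a b L d : R) : 0 < d -> -L <= a -> b <= L -> a + d <= b ->
  exists2 k, (k < (Num.truncn (2 * L / d)).+2)%N & a < - L + k%:R * d <= b.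
Proof.
move=> d0 La bL ab; have z0 : 0 <= (a + L) / d by apply: divr_ge0; [lra|exact: ltW].
have := truncn_itv z0; set k := Num.truncn _ => /andP[k1 k2].
exists k.+1.
  rewrite ltnS; apply: leq_trans (_ : k.+1 <= _)%N => //; rewrite ltnS.
  by apply: le_truncn; rewrite ler_pM2r ?invr_gt0//; lra.
rewrite ltr_pdivrMr// in k2; rewrite ler_pdivlMr// in k1.
move: k1 k2; rewrite -addn1 natrD mulrDl mul1r => k1 k2; apply/andP; split; lra.
Qed.

Section Selection.
Variables (n : nat) (D : R -> R -> (nat -> R) -> Prop) (L : R).
(** The offset [o] is arbitrary because one formula must speak of a point and of its competitor at
    once. *)
Hypothesis D_def : forall o, definable (fun e => D (e 0%N) (e 1%N) (fun i => e (o + i)%N)).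
Hypothesis D_agree : forall v t x z, agree n x z -> D v t x -> D v t z.
Hypothesis D_compact : forall v t, compact [set u : 'rV[R]_n | D v t (coords u)].
Hypothesis D_bound : forall v t x, D v t x -> forall i, (i < n)%N -> `|x i| <= L.

(** Lexicographic minimality determines the first [n] entries by a formula; an arbitrary choice of a
    point need not be definable. *)
Let lexmin v t x := D v t x /\ forall z, D v t z -> lexle n x z.

Let lexmin_ex v t x : D v t x -> exists z, lexmin v t z.
Proof.
pose row (x : nat -> R) : 'rV[R]_n := \row_i x i.
have rowE y : agree n y (coords (row y)).
  by move=> i im; rewrite -[i]/(val (Ordinal im)) coords_ord mxE.
move=> Dx; have [|u Du umin] := lexmin_exists (@D_compact v t).
  by exists (row x); apply: D_agree Dx; exact: rowE.
exists (coords u); split=> // z Dz.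
have := umin (row z) (D_agree (rowE z) Dz).
have zE i : (i < n)%N -> coords (row z) i = z i by move=> /rowE.
move=> [uz|[i im [uz uzi]]]; [left|right].
  by move=> i im; rewrite uz// zE.
exists i => //; rewrite -zE//; split=> // j ji.
by rewrite uz// zE// (ltn_trans ji).
Qed.

Lemma lexle_agree x x' z z' : agree n x x' -> agree n z z' ->
  lexle n x z -> lexle n x' z'.
Proof.
move=> xx zz [xz|[i im [xz xzi]]]; [left|right].
  by move=> i im; rewrite -xx// -zz// xz.
exists i => //; rewrite -xx// -zz//; split=> // j ji.
by rewrite -xx ?(ltn_trans ji)// -zz ?(ltn_trans ji)// xz.
Qed.

Lemma agree_sym m x z : agree m x z -> agree m z x.
Proof. by move=> xz i im; rewrite xz. Qed.

(* The variables 0, 1, 2 are [v], [t] and the level; [x] is stored from 3 on,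
   and its competitor [z] from [3 + n] on. *)
Let level_def i : (i < n)%N -> definable (fun e => exists x, lexmin (e 0%N) (e 1%N) x /\ e 2%N <= x i).
Proof.
move=> im; pose Q e := (D (e 0%N) (e 1%N) (fun j => e (3 + j)%N) /\
  forall z, let e' := upd_block e (3 + n) n z in
     D (e' 0%N) (e' 1%N) (fun j => e' (3 + n + j)%N) ->
     lexle n (fun j => e' (3 + j)%N) (fun j => e' (3 + n + j)%N)) /\
  e 2%N <= e (3 + i)%N.
have dQ : definable Q.
  apply: definable_and; last by apply: definable_le; exact: polyfun_var.
  apply: definable_and; first exact: D_def.
  apply: (@definable_forall_block R (fun e' => D (e' 0%N) (e' 1%N) (fun j => e' (3 + n + j)%N) ->
     lexle n (fun j => e' (3 + j)%N) (fun j => e' (3 + n + j)%N))).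
  apply: definable_imply; first exact: D_def.
  apply: definable_or.
    apply: definable_bforall => j; apply: definable_eq; exact: polyfun_var.
  apply: definable_bexists => j; apply: definable_and.
    apply: definable_bforall => l; apply: definable_eq; exact: polyfun_var.
  by apply: definable_lt; exact: polyfun_var.
have block_in e k m x : agree m (fun j => upd_block e k m x (k + j)%N) x.
  by move=> j jm; rewrite /upd_block leq_addr ltn_add2l jm addKn.
apply: definable_ext (definable_exists_block 3 n dQ) => e.
(* The competitor is written beyond the block of [x], which it leaves intact. *)
have E x z : let e1 := upd_block e 3 n x in let e' := upd_block e1 (3 + n) n z in
    agree n (fun j => e' (3 + j)%N) x.
  move=> e1 e' j jn; rewrite /e' /upd_block leq_add2l leqNgt jn /= -/(upd_block e 3 n x).
  exact: block_in.
split=> -[x]; rewrite /Q.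
  move=> [[Dx xmin] ix]; exists x; split; last first.
    by move: ix; rewrite (block_in e 3 n x i im).
  split=> [|z Dz]; first by apply: D_agree Dx; exact: block_in.
  have /= := xmin z; move=> H; apply: lexle_agree (H _).
  - exact: E.
  - exact: block_in.
  - by apply: D_agree Dz; apply/agree_sym; exact: block_in.
move=> [[Dx xmin] ix]; exists x; split; last first.
  by rewrite (block_in e 3 n x i im).
split; first by apply: D_agree Dx; apply/agree_sym; exact: block_in.
move=> z /= Dz.
apply: (@lexle_agree x _ z).
- by apply/agree_sym; exact: E.
- by apply/agree_sym; exact: block_in.
- by apply: xmin; apply: D_agree Dz; exact: block_in.
Qed.

(* For the lexicographic minimum, each condition [y <= sel v t i] on [v] is
   definable, so it changes at most [M] times; a jump of size [d] crosses one of
   the levels [y] of a grid of mesh [d]. *)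
Lemma definable_selection : exists sel : R -> R -> nat -> R, exists M : nat,
  (forall v t x, D v t x -> D v t (sel v t)) /\
  forall i, (i < n)%N -> forall t d (v : nat -> R) N, 0 < d ->
    (forall j, (j < N)%N -> v j.+1 < v j) ->
    (forall j, (j <= N)%N -> exists x, D (v j) t x) ->
    (\sum_(j < N) (d <= `|sel (v j) t i - sel (v j.+1) t i|)%R <=
      M * (Num.truncn (2 * L / d)).+2)%N.
Proof.
have [sel selP] : {sel : R * R -> nat -> R & forall p,
    (exists x, D p.1 p.2 x) -> lexmin p.1 p.2 (sel p)}.
  apply: (@boolp.choice (R * R)%type (nat -> R) (fun p z => (exists x, D p.1 p.2 x) -> lexmin p.1 p.2 z)) => p.
  have [[x Dx]|nD] := pselect (exists x, D p.1 p.2 x).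
    by have [z Dz] := lexmin_ex Dx; exists z.
  by exists (fun=> 0) => /nD.
pose P i (e : nat -> R) := exists x, lexmin (e 0%N) (e 1%N) x /\ e 2%N <= x i.
have [M HM] : {M : nat -> nat & forall i, (i < n)%N ->
    forall (e : seq R) (v : nat -> R) N, (forall j, (j < N)%N -> v j.+1 < v j) ->
    (\sum_(j < N) (`[< P i (upd (fun i => nth 0%R e i) 0 (v j)) >] !=
                   `[< P i (upd (fun i => nth 0%R e i) 0 (v j.+1)) >]) <= M i)%N}.
  apply: (@boolp.choice nat nat (fun i m => (i < n)%N -> forall (e : seq R) (v : nat -> R) N,
    (forall j, (j < N)%N -> v j.+1 < v j) ->
    (\sum_(j < N) (`[< P i (upd (fun i => nth 0%R e i) 0 (v j)) >] !=
      `[< P i (upd (fun i => nth 0%R e i) 0 (v j.+1)) >]) <= m)%N)) => i.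
  have [im|_] := ltnP i n; last by exists 0%N.
  have [m Hm] := definable_crossings 0 (level_def im).
  by exists m => _; exact: Hm.
exists (fun v t => sel (v, t)), (\max_(i < n) M i); split.
  by move=> v t x Dx; have [] := selP (v, t) (ex_intro _ x Dx).
move=> i im t d v N d0 dec Dv.
set K := (Num.truncn (2 * L / d)).+2.
pose y (k : nat) : R := - L + k%:R * d.
pose a j := sel (v j, t) i.
(* Entry 0 is overwritten by [v j]. As lexicographic minima agree on [n] entries, the existential in
   [P] speaks of [sel] itself. *)
have Pa (k : nat) j : (j <= N)%N ->
    `[< P i (upd (fun i => nth 0 [:: 0; t; y k] i) 0 (v j)) >] = (y k <= a j).
  move=> jN; have [Dj mj] := selP (v j, t) (Dv j jN).
  apply/asboolP/idP => [[x [[/= Dx mx]]]|yka]; last by exists (sel (v j, t)).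
  by rewrite /upd /= /a (lexle_anti (mj x Dx) (mx _ Dj)).
have aL j : (j <= N)%N -> - L <= a j <= L.
  move=> jN; have [Dj _] := selP (v j, t) (Dv j jN).
  by rewrite -ler_norml; exact: (D_bound Dj).
apply: leq_trans (_ : \sum_(k < K) \sum_(j < N) ((y k <= a j)%R != (y k <= a j.+1)%R) <= _)%N.
  rewrite exchange_big /=; apply: leq_sum => j _.
  have jN := ltn_ord j; have /andP[l1 u1] := aL j (ltnW jN).
  have /andP[l2 u2] := aL j.+1 jN.
  rewrite -/(a j) -/(a j.+1); case: lerP => // dj.
  have [k kK Hk] : exists2 k, (k < K)%N & (y k <= a j) != (y k <= a j.+1).
    have [l|g] := leP (a j) (a j.+1).
      have adj : a j + d <= a j.+1.
        by move: dj; rewrite distrC ger0_norm ?subr_ge0//; lra.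
      have [k kK /andP[k1 k2]] := grid_point d0 l1 u2 adj.
      by exists k => //; rewrite /y k2 leNgt k1.
    have adj : a j.+1 + d <= a j.
      by move: dj; rewrite ger0_norm ?subr_ge0; [lra|exact: ltW].
    have [k kK /andP[k1 k2]] := grid_point d0 l2 u1 adj.
    by exists k => //; rewrite /y k2 leNgt k1.
  by rewrite (bigD1 (Ordinal kK)) //= Hk.
apply: leq_trans (_ : \sum_(k < K) \max_(i < n) M i <= _)%N; last first.
  by rewrite sum_nat_const card_ord mulnC.
apply: leq_sum => k _.
apply: leq_trans (leq_bigmax (Ordinal im)).
apply: leq_trans (HM i im [:: 0; t; y k] v N dec).
apply: leq_sum => j _; rewrite !Pa//; exact: ltnW.
Qed.
End Selection.

End Crossings.

(** * Forms, norms and the derivatives of the model *)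

Section Multilinear.
Context {R : realType} {n : nat}.
Implicit Types (A W : 'M[R]_n) (T : tensor3 R n) (u v w x s : 'cV[R]_n).

(** Polar forms: [quad A s] and [cubic T s] are [bil A s s] and [tri T s s s] by conversion, and
    later proofs switch between them in this way. *)
Definition bil A u v : R := (u^T *m A *m v) 0 0.

Definition tri T u v w : R :=
  \sum_i \sum_j \sum_k T i j k * u i 0 * v j 0 * w k 0.

Lemma dotPl a u v w : dot (a *: u + v) w = a * dot u w + dot v w.
Proof. by rewrite /dot linearP mulmxDl -scalemxAl !mxE. Qed.

Lemma dotC u v : dot u v = dot v u.
Proof.
rewrite /dot [LHS](_ : _ = (u^T *m v)^T 0 0); last by rewrite [RHS]mxE.
by rewrite trmx_mul trmxK.
Qed.

Lemma dotPr a u v w : dot w (a *: u + v) = a * dot w u + dot w v.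
Proof. by rewrite dotC dotPl !(dotC w). Qed.

Lemma dotE u v : dot u v = \sum_i u i 0 * v i 0.
Proof. by rewrite /dot mxE; apply: eq_bigr => i _; rewrite mxE. Qed.

Lemma bilPl A a u v w : bil A (a *: u + v) w = a * bil A u w + bil A v w.
Proof. by rewrite /bil linearP !mulmxDl -!scalemxAl !mxE. Qed.

Lemma bilPr A a u v w : bil A w (a *: u + v) = a * bil A w u + bil A w v.
Proof. by rewrite /bil mulmxDr -scalemxAr !mxE. Qed.

Lemma dotZl a u v : dot (a *: u) v = a * dot u v.
Proof. by rewrite /dot linearZ /= -scalemxAl mxE. Qed.

Lemma bilZl A a u v : bil A (a *: u) v = a * bil A u v.
Proof. by rewrite /bil linearZ /= -!scalemxAl mxE. Qed.

Lemma bilZr A a u v : bil A u (a *: v) = a * bil A u v.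
Proof. by rewrite /bil -scalemxAr mxE. Qed.

Lemma bilC A u v : symmetric_mx A -> bil A u v = bil A v u.
Proof.
move=> sA; rewrite /bil [LHS](_ : _ = (u^T *m A *m v)^T 0 0); last by rewrite [RHS]mxE.
by rewrite !trmx_mul trmxK sA mulmxA.
Qed.

Lemma bilE A u v : bil A u v = \sum_i \sum_j A i j * u i 0 * v j 0.
Proof.
rewrite /bil mxE exchange_big /=; apply: eq_bigr => j _.
rewrite mxE mulr_suml; apply: eq_bigr => i _.
by rewrite mxE; ring.
Qed.

Lemma triP1 T a u u' v w : tri T (a *: u + u') v w = a * tri T u v w + tri T u' v w.
Proof.
rewrite /tri mulr_sumr -big_split /=; apply: eq_bigr => i _.
rewrite mulr_sumr -big_split /=; apply: eq_bigr => j _.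
rewrite mulr_sumr -big_split /=; apply: eq_bigr => k _.
by rewrite !mxE; ring.
Qed.

Lemma triC12 T u v w : symmetric_tensor T -> tri T u v w = tri T v u w.
Proof.
move=> sT; rewrite /tri exchange_big /=; apply: eq_bigr => i _.
apply: eq_bigr => j _; apply: eq_bigr => k _.
by rewrite (sT j i k).1; ring.
Qed.

Lemma triC23 T u v w : symmetric_tensor T -> tri T u v w = tri T u w v.
Proof.
move=> sT; rewrite /tri; apply: eq_bigr => i _.
rewrite exchange_big /=; apply: eq_bigr => j _; apply: eq_bigr => k _.
by rewrite (sT i k j).2; ring.
Qed.

Lemma triP2 T a u v v' w : symmetric_tensor T ->
  tri T u (a *: v + v') w = a * tri T u v w + tri T u v' w.
Proof. by move=> sT; rewrite triC12// triP1 !(triC12 _ u _ sT). Qed.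

Lemma triP3 T a u v w w' : symmetric_tensor T ->
  tri T u v (a *: w + w') = a * tri T u v w + tri T u v w'.
Proof. by move=> sT; rewrite triC23// triP2// !(triC23 _ v _ sT). Qed.

Lemma lin_scale (l : 'cV[R]_n -> R) a u :
  (forall a u v, l (a *: u + v) = a * l u + l v) -> l (a *: u) = a * l u.
Proof.
move=> lP; have l0 : l 0 = 0.
  by have := lP (-1) 0 0; rewrite scaler0 addr0; lra.
by rewrite -[a *: u]addr0 lP l0 addr0.
Qed.

Lemma basis_sum (l : 'cV[R]_n -> R) s :
  (forall a u v, l (a *: u + v) = a * l u + l v) ->
  l s = \sum_i l (basis_vec i) * s i 0.
Proof.
move=> lP; have sE : s = \sum_i (s i 0 *: basis_vec i : 'cV[R]_n).
  apply/colP => i; rewrite summxE (bigD1 i)//= big1 => [|j ji].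
    by rewrite !mxE !eqxx mulr1 addr0.
  by rewrite !mxE eqxx eq_sym (negPf ji) mulr0.
have l0 : l 0 = 0 by rewrite -(scale0r (0 : 'cV[R]_n)) lin_scale// mul0r.
rewrite {1}sE; elim/big_rec2: _ => [//|i y1 y2 _ <-].
by rewrite lP mulrC.
Qed.

(** On a line the model has degree 4 and its gradient degree 3, so a remainder of this polynomial
    shape covers both and reduces first and second derivatives to ring identities. *)
Lemma derive_line (F : 'cV[R]_n -> R) x v c (b0 b1 b2 : R) :
  (forall h, F (h *: v + x) = F x + h * c + h ^+ 2 * (b0 + h * b1 + h ^+ 2 * b2)) ->
  'D_v (F : 'cV[R]_n -> R^o) x = c.
Proof.
move=> FE; apply: cvg_lim => //.
(* The difference quotient, extended continuously to [h = 0]. *)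
pose G h : R := c + h * (b0 + h * b1 + h ^+ 2 * b2).
have cG : G @ 0^' --> c.
  have cG0 : G @ (0 : R) --> G 0.
    apply: cvgD; first exact: cvg_cst.
    apply: cvgM; first exact: cvg_id.
    apply: cvgD; last by apply: cvgM; [exact: exprn_continuous|exact: cvg_cst].
    by apply: cvgD; [exact: cvg_cst|apply: cvgM; [exact: cvg_id|exact: cvg_cst]].
  have G0 : G 0 = c by rewrite /G mul0r addr0.
  by rewrite G0 in cG0; apply: cvg_within_filter.
apply: cvg_trans cG; apply: near_eq_cvg; near=> h.
have h0 : h != 0 by near: h; exact: nbhs_dnbhs_neq.
rewrite /G /= FE /GRing.scale /=; field.
by [].
Unshelve. all: by end_near.
Qed.
End Multilinear.

Section Norms.
Context {R : realType} {n : nat}.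
Implicit Types (A W : 'M[R]_n) (T : tensor3 R n) (u v w x s : 'cV[R]_n).

Lemma dot_ge0 v : 0 <= dot v v.
Proof. by rewrite dotE sumr_ge0// => i _; rewrite -expr2 sqr_ge0. Qed.

Lemma norm2_ge0 v : 0 <= norm2 v.
Proof. exact: sqrtr_ge0. Qed.

Lemma sqr_norm2 v : norm2 v ^+ 2 = dot v v.
Proof. by rewrite sqr_sqrtr// dot_ge0. Qed.

Lemma coord_norm2 v i : `|v i 0| <= norm2 v.
Proof.
rewrite -sqrtr_sqr ler_wsqrtr// dotE (bigD1 i)//= -expr2 lerDl.
by apply: sumr_ge0 => j _; rewrite -expr2 sqr_ge0.
Qed.

Lemma dot_eq0 v : dot v v = 0 -> v = 0.
Proof.
move=> v0; apply/colP => i; rewrite mxE; apply/eqP; rewrite -normr_le0.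
by apply: le_trans (coord_norm2 v i) _; rewrite /norm2 v0 sqrtr0.
Qed.

Lemma dot_bound u : exists2 K, 0 <= K & forall v, `|dot u v| <= K * norm2 v.
Proof.
exists (\sum_i `|u i 0|) => [|v]; first exact: sumr_ge0.
rewrite dotE mulr_suml; apply: le_trans (ler_norm_sum _ _ _) _.
by apply: ler_sum => i _; rewrite normrM ler_wpM2l// coord_norm2.
Qed.

Lemma bil_bound A : exists2 K, 0 <= K &
  forall u v, `|bil A u v| <= K * norm2 u * norm2 v.
Proof.
exists (\sum_i \sum_j `|A i j|) => [|u v].
  by apply: sumr_ge0 => i _; exact: sumr_ge0.
rewrite bilE 2!mulr_suml; apply: le_trans (ler_norm_sum _ _ _) _.
apply: ler_sum => i _; rewrite 2!mulr_suml; apply: le_trans (ler_norm_sum _ _ _) _.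
apply: ler_sum => j _; rewrite !normrM.
by rewrite ler_pM// ?mulr_ge0// ?ler_wpM2l// coord_norm2.
Qed.

Lemma tri_bound T : exists2 K, 0 <= K &
  forall u v w, `|tri T u v w| <= K * norm2 u * norm2 v * norm2 w.
Proof.
exists (\sum_i \sum_j \sum_k `|T i j k|) => [|u v w].
  by do 2?[apply: sumr_ge0 => ? _]; exact: sumr_ge0.
rewrite /tri 3!mulr_suml; apply: le_trans (ler_norm_sum _ _ _) _.
apply: ler_sum => i _; rewrite 3!mulr_suml; apply: le_trans (ler_norm_sum _ _ _) _.
apply: ler_sum => j _; rewrite 3!mulr_suml; apply: le_trans (ler_norm_sum _ _ _) _.
apply: ler_sum => k _; rewrite !normrM.
rewrite ler_pM// ?mulr_ge0// ?coord_norm2//.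
by rewrite ler_pM// ?mulr_ge0// ?ler_wpM2l// coord_norm2.
Qed.

Lemma quad_ge0 W v : pos_def W -> 0 <= quad W v.
Proof.
move=> pW; have [->|/pW/ltW//] := eqVneq v 0.
by rewrite /quad mulmx0 mxE.
Qed.

Lemma normW_ge0 W v : 0 <= normW W v.
Proof. exact: sqrtr_ge0. Qed.

Lemma sqr_normW W v : pos_def W -> normW W v ^+ 2 = bil W v v.
Proof. by move=> pW; rewrite sqr_sqrtr// quad_ge0. Qed.

(** The polynomial is nonnegative and vanishes at 0, so 0 is a minimum. This replaces
    differentiation wherever a first-order condition is needed. *)
Lemma linear_coef0 (a b c e : R) :
  (forall h, 0 <= a * h + b * h ^+ 2 + c * h ^+ 3 + e * h ^+ 4) -> a = 0.
Proof.
move=> H; apply/eqP; apply/negPn/negP => a0.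
pose K := 1 + `|b| + `|c| + `|e|.
have K1 : 1 <= K by rewrite /K -!addrA lerDl !addr_ge0.
have bound h : `|h| <= 1 -> - (a * h) <= K * h ^+ 2.
  move=> h1; have := H h.
  have h2 : h ^+ 2 <= 1 by rewrite -[leLHS]ger0_norm ?sqr_ge0// normrX exprn_ile1.
  have s0 := sqr_ge0 h.
  have B : b * h ^+ 2 <= `|b| * h ^+ 2 by rewrite ler_wpM2r// ler_norm.
  have C : c * h ^+ 3 <= `|c| * h ^+ 2.
    apply: le_trans (ler_norm _) _; rewrite normrM ler_wpM2l// exprS normrM.
    by rewrite [X in _ * X]ger0_norm// ler_piMl.
  have E : e * h ^+ 4 <= `|e| * h ^+ 2.
    apply: le_trans (ler_norm _) _; rewrite normrM ler_wpM2l//.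
    rewrite (exprD h 2 2) normrM !(ger0_norm s0).
    by rewrite ler_piMl.
  by rewrite /K; lra.
(* A step against the sign of [a]; the factor [1 + |a|] keeps its length at most 1 and makes the
   linear gain strictly larger than [K * h ^+ 2]. *)
pose h := - (a / (K * (1 + `|a|))).
have N1 : 0 < 1 + `|a| by have := normr_ge0 a; lra.
have K0 : 0 < K by lra.
have Ka : 0 < K * (1 + `|a|) by rewrite mulr_gt0.
have h1 : `|h| <= 1.
  rewrite normrN normf_div (gtr0_norm Ka) ler_pdivrMr// mul1r.
  apply: le_trans (_ : 1 + `|a| <= _); first by rewrite lerDr.
  by rewrite ler_peMl// ltW.
have := bound h h1.
have -> : - (a * h) = a ^+ 2 / (K * (1 + `|a|)).
  by rewrite /h; field; rewrite !gt_eqF.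
have -> : K * h ^+ 2 = a ^+ 2 / (K * (1 + `|a|)) / (1 + `|a|).
  by rewrite /h; field; rewrite !gt_eqF.
set z := _ / _; have z0 : 0 < z by rewrite divr_gt0// exprn_even_gt0.
rewrite leNgt ltr_pdivrMr//.
by rewrite ltr_pMr// ltrDl normr_gt0 a0.
Qed.

(* The quotient of [p(l) - p(1)] by [(l - 1)^2] is a nonnegative quadratic in
   [l]; the claim is the sign of its discriminant. *)
Lemma quartic_ray_min (a b c e : R) : 0 < e ->
  (forall l, a + b / 2 + c / 6 + e / 4 <=
     a * l + b / 2 * l ^+ 2 + c / 6 * l ^+ 3 + e / 4 * l ^+ 4) ->
  (3 * e + c) ^+ 2 <= 36 * e * - (a + b / 2 + c / 6 + e / 4).
Proof.
move=> e0 H.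
have d0 : a + b + c / 2 + e = 0.
  apply: (@linear_coef0 _ (b / 2 + c / 2 + 3 / 2 * e) (c / 6 + e) (e / 4)) => h.
  have := H (1 + h); rewrite -subr_ge0; congr (0 <= _); by field.
have aE : a = - (b + c / 2 + e) by lra.
pose q l := e / 4 * l ^+ 2 + (e / 2 + c / 6) * l + (3 / 4 * e + c / 3 + b / 2).
have qH l : 0 <= (l - 1) ^+ 2 * q l.
  by have := H l; rewrite -subr_ge0 aE; congr (0 <= _); rewrite /q; field.
have q0 l : l != 1 -> 0 <= q l.
  move=> l1; have := qH l; rewrite pmulr_rge0//.
  by rewrite exprn_even_gt0//= subr_eq0.
have q1 l : 0 <= q l.
  have [->|/q0//] := eqVneq l 1.
  rewrite leNgt; apply/negP => qn.
  (* If [q 1] were negative, [q] would still be negative at [1 + d], against [q0]. *)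
  pose d : R := Num.min 1 (- q 1 / (2 * (e + `|e / 2 + c / 6|))).
  have S : 0 < e + `|e / 2 + c / 6| by rewrite ltr_wpDr.
  have d_gt : 0 < d by rewrite lt_min ltr01 divr_gt0//; lra.
  have d1 : d <= 1 by rewrite ge_min lexx.
  have d2 : d * (2 * (e + `|e / 2 + c / 6|)) <= - q 1.
    by rewrite -ler_pdivlMr ?ge_min ?lexx ?orbT//; lra.
  have := q0 (1 + d); rewrite -subr_eq0 addrC addKr gt_eqF// => /(_ isT).
  have -> : q (1 + d) = q 1 + d * (e / 2 + e / 4 * d + (e / 2 + c / 6)).
    by rewrite /q; field.
  have ns := ler_norm (e / 2 + c / 6).
  have : e / 2 + e / 4 * d + (e / 2 + c / 6) <= 2 * (e + `|e / 2 + c / 6|) - (e/4).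
    have : 0 <= `|e / 2 + c / 6| by [].
    have : e / 4 * d <= e / 4 by rewrite ger_pMr//; lra.
    lra.
  move=> /(ler_wpM2l (ltW d_gt)); have : 0 < d * (e / 4) by rewrite mulr_gt0//; lra.
  lra.
(* The vertex of the parabola [q]. *)
have := q1 (- (e + c / 3) / e).
have -> : q (- (e + c / 3) / e) =
    ((36 * e * - (a + b / 2 + c / 6 + e / 4)) - (3 * e + c) ^+ 2) / (36 * e).
  by rewrite aE /q; field; rewrite gt_eqF.
rewrite pmulr_lge0 ?subr_ge0// invr_gt0; lra.
Qed.
End Norms.

Section Derivatives.
Context {R : realType} {n : nat}.
Variables (f0 : R) (g : 'cV[R]_n) (H : 'M[R]_n) (T : tensor3 R n)
    (sigma : R) (W : 'M[R]_n).
Hypotheses (sH : symmetric_mx H) (sT : symmetric_tensor T)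
  (sW : symmetric_mx W) (pW : pos_def W).
Implicit Types (u v w x s : 'cV[R]_n).
Local Notation m3 := (ar3_model f0 g H T sigma W).

Definition grad_form x u := dot g u + bil H x u + 1 / 2 * tri T u x x
  + sigma * bil W x x * bil W u x.

Definition hess_form x u v := bil H u v + tri T u v x
  + sigma * (bil W x x * bil W u v + 2 * bil W u x * bil W v x).

Definition third_form x u v w := tri T u v w
  + 2 * sigma * (bil W u x * bil W v w + bil W v x * bil W u w
                 + bil W w x * bil W u v).

(** The Taylor expansion of a quartic is exact, so the estimates that use it have no remainder to
    control. *)
Lemma model_line x v h : m3 (h *: v + x) = m3 x + h * grad_form x v
  + h ^+ 2 * (hess_form x v v / 2 + h * (third_form x v v v / 6) + h ^+ 2 * (sigma / 4 * bil W v v ^+ 2)).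
Proof.
rewrite /ar3_model !(exprM (normW _ _) 2 2) !sqr_normW//.
rewrite -!/(bil _ _ _) -!/(tri _ _ _ _) /grad_form /hess_form /third_form.
rewrite -[quad H x]/(bil H x x) -[quad H (_ + _)]/(bil H (_ + _) (_ + _)).
rewrite -[cubic T x]/(tri T x x x) -[cubic T (_ + _)]/(tri T (_ + _) (_ + _) (_ + _)).
rewrite !dotPr !bilPl !bilPr !triP1 !triP2// !triP3//.
rewrite (bilC x v sH) (bilC x v sW) (triC12 x v v sT) (triC23 v x v sT).
rewrite (triC12 x v x sT) (triC23 x x v sT) (triC12 x v x sT).
by field.
Qed.

Lemma grad_form_line x u v h : grad_form (h *: v + x) u = grad_form x u + h * hess_form x u v
  + h ^+ 2 * (third_form x u v v / 2 + h * (sigma * bil W v v * bil W u v)).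
Proof.
rewrite /grad_form /hess_form /third_form !bilPl !bilPr !triP2// !triP3//.
rewrite (bilC x v sW) (bilC x u sH) (bilC v u sH) (triC23 u x v sT).
by field.
Qed.

Lemma partial1E i x : partial i m3 x = grad_form x (basis_vec i).
Proof. by apply: derive_line => h; rewrite model_line. Qed.

Lemma partial2E i j x :
  partial i (partial j m3) x = hess_form x (basis_vec j) (basis_vec i).
Proof.
rewrite (_ : partial j m3 = fun y => grad_form y (basis_vec j)); last first.
  by apply/funext => y; exact: partial1E.
apply: (@derive_line _ _ _ _ _ _ _ _ 0) => h; rewrite grad_form_line mulr0 addr0.
by [].
Qed.

Lemma grad_formP x a u v : grad_form x (a *: u + v) = a * grad_form x u + grad_form x v.
Proof. by rewrite /grad_form dotPr bilPr bilPl triP1; ring. Qed.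

Lemma hess_formP1 x a u u' v : hess_form x (a *: u + u') v = a * hess_form x u v + hess_form x u' v.
Proof. by rewrite /hess_form !bilPl triP1; ring. Qed.

Lemma hess_formP2 x a u v v' : hess_form x u (a *: v + v') = a * hess_form x u v + hess_form x u v'.
Proof. by rewrite /hess_form !bilPr bilPl triP2//; ring. Qed.

Lemma dot_grad x s : dot (grad m3 x) s = grad_form x s.
Proof.
rewrite dotE (@basis_sum _ _ (grad_form x)); last exact: grad_formP.
by apply: eq_bigr => i _; rewrite mxE partial1E.
Qed.

Lemma hess_bil x u v : bil (hess m3 x) u v = hess_form x v u.
Proof.
rewrite bilE.
rewrite (@basis_sum _ _ (fun z => hess_form x z u)); last by move=> *; exact: hess_formP1.
rewrite exchange_big /=; apply: eq_bigr => j _.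
rewrite (@basis_sum _ _ (hess_form x (basis_vec j))); last by move=> *; exact: hess_formP2.
by rewrite mulr_suml; apply: eq_bigr => i _; rewrite mxE partial2E.
Qed.

End Derivatives.

(** * Polynomial conditions on coordinates: closedness and compactness *)

Section PolynomialSets.
Context {R : realType} {n : nat}.

Definition vec (o : nat) (e : nat -> R) : 'cV[R]_n := \col_i e (o + i)%N.

Lemma vec_coords (u : 'rV[R]_n) : vec 0 (coords u) = u^T.
Proof. by apply/colP => i; rewrite !mxE coords_ord. Qed.

Lemma polyfun_ext (F G : (nat -> R) -> R) : F =1 G -> polyfun F -> polyfun G.
Proof. by move=> FG [t rt tE]; exists t => // e; rewrite -FG. Qed.

Definition polyvec (U : (nat -> R) -> 'cV[R]_n) := forall i, polyfun (fun e => U e i 0).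

Lemma polyvec_const u : polyvec (fun=> u).
Proof. by move=> i; exact: polyfun_const. Qed.

Lemma polyvec_vec o : polyvec (vec o).
Proof.
by move=> i; apply: (@polyfun_ext (fun e => e (o + i)%N)) => [e|];
  [rewrite mxE|exact: polyfun_var].
Qed.

Lemma polyfun_dot U V : polyvec U -> polyvec V -> polyfun (fun e => dot (U e) (V e)).
Proof.
move=> pU pV; apply: (polyfun_ext (fun e => esym (dotE (U e) (V e)))).
by apply: polyfun_sum => i; exact: polyfunM.
Qed.

Lemma polyfun_bil A U V : polyvec U -> polyvec V ->
  polyfun (fun e => bil A (U e) (V e)).
Proof.
move=> pU pV; apply: (polyfun_ext (fun e => esym (bilE A (U e) (V e)))).
do 2!(apply: polyfun_sum => ?); apply: polyfunM => //.
by apply: polyfunM => //; exact: polyfun_const.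
Qed.

Lemma polyfun_tri (T : tensor3 R n) U V X : polyvec U -> polyvec V -> polyvec X ->
  polyfun (fun e => tri T (U e) (V e) (X e)).
Proof.
move=> pU pV pX; do 3!(apply: polyfun_sum => ?).
do 2!(apply: polyfunM => //).
by apply: polyfunM => //; exact: polyfun_const.
Qed.

Lemma closed_polyfun_le F c : polyfun F ->
  closed [set u : 'rV[R]_n | F (coords u) <= c].
Proof.
move=> /polyfun_continuous -/(_ n) cF.
rewrite -[X in closed X]/((fun u : 'rV[R]_n => F (coords u)) @^-1` [set x | x <= c]).
apply: closed_comp; [move=> u _; exact: cF|exact: closed_le].
Qed.

Lemma closed_polyfun_eq F c : polyfun F ->
  closed [set u : 'rV[R]_n | F (coords u) = c].
Proof.
move=> /polyfun_continuous -/(_ n) cF.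
rewrite -[X in closed X]/((fun u : 'rV[R]_n => F (coords u)) @^-1` [set x | x = c]).
apply: closed_comp; [move=> u _; exact: cF|exact: closed_eq].
Qed.

Lemma compact_coord_bound (A : set 'rV[R]_n) L : closed A ->
  (forall u, A u -> forall i, `|u 0 i| <= L) -> compact A.
Proof.
move=> cA bA; apply: bounded_closed_compact => //.
exists (Num.max 0 L); split; first exact: num_real.
move=> M; rewrite gt_max => /andP[M0 LM] u /= Au.
rewrite /Num.norm/= mx_normrE; apply/bigmax_leP; split => [|[i j] _ /=]; first exact: ltW.
by rewrite ord1; apply: le_trans (bA u Au j) (ltW LM).
Qed.

End PolynomialSets.

(** * The smallest eigenvalue and bounds in the weighted norm *)

Section Rayleigh.
Context {R : realType} {n : nat}.
Implicit Types (A W : 'M[R]_n) (u v w : 'cV[R]_n).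

Lemma cauchy_schwarz u v : dot u v <= norm2 u * norm2 v.
Proof.
apply: le_trans (ler_norm _) _; rewrite -sqrtr_sqr -sqrtrM ?dot_ge0//.
rewrite ler_wsqrtr//; have [u0|u0] := eqVneq (dot u u) 0; last first.
  have up : 0 < dot u u by rewrite lt_def u0 dot_ge0.
  have := dot_ge0 (- (dot u v / dot u u) *: u + v).
  rewrite dotPl !dotPr (dotC v u) => E.
  rewrite -subr_ge0 -(pmulr_rge0 _ (_ : 0 < (dot u u)^-1)) ?invr_gt0//.
  by apply: le_trans E _; rewrite le_eqVlt; apply/orP; left; apply/eqP; field.
by rewrite (dot_eq0 u0) [dot 0 v]/dot [dot 0 0]/dot trmx0 !mul0mx !mxE expr0n /= mul0r.
Qed.

(* A minimizer of [quad A] on the unit sphere is an eigenvector. *)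
Lemma lambda_minP A : (0 < n)%N -> symmetric_mx A -> pos_def A ->
  0 < lambda_min A /\ forall v, lambda_min A * dot v v <= quad A v.
Proof.
move=> n0 sA pA.
pose S := [set u : 'rV[R]_n | dot u^T u^T = 1].
have dE (u : 'rV[R]_n) : dot u^T u^T = bil (1%:M : 'M[R]_n) (vec 0 (coords u)) (vec 0 (coords u)).
  by rewrite /dot /bil mulmx1 vec_coords.
have cS : compact S.
  apply: (@compact_coord_bound _ _ _ 1).
    have -> : S = [set u | (fun e => bil (1%:M : 'M[R]_n) (@vec R n 0 e) (vec 0 e)) (coords u) = 1].
      by apply/seteqP; split=> u /=; rewrite /S /= dE.
    exact: (@closed_polyfun_eq R n _ 1 (@polyfun_bil R n 1%:M _ _ (polyvec_vec 0) (polyvec_vec 0))).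
  move=> u /= Su i; have := coord_norm2 u^T i; rewrite mxE /norm2 Su.
  by rewrite sqrtr1.
have S0 : S !=set0.
  exists (delta_mx 0 (Ordinal n0)); rewrite /S /= dotE (bigD1 (Ordinal n0)) //=.
  rewrite !mxE !eqxx mulr1 big1 ?addr0// => i i0.
  by rewrite !mxE (negPf i0) mulr0.
pose f (u : 'rV[R]_n) := quad A u^T.
have cf : continuous f.
  have -> : f = fun u : 'rV[R]_n =>
      (fun e => bil A (@vec R n 0 e) (@vec R n 0 e)) (coords u).
    by apply/funext => u; rewrite vec_coords.
  exact: (@polyfun_continuous R _ n (@polyfun_bil R n A _ _ (polyvec_vec 0) (polyvec_vec 0))).
have [c /set_mem Sc cmin] := @compact_EVT_min _ _ f S S0 cS (continuous_subspaceT cf).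
pose x := c^T; pose mu := quad A x.
have mumin v : mu * dot v v <= quad A v.
  have [->|v0] := eqVneq v 0.
    by rewrite /dot /quad !mulmx0 mxE mulr0.
  have vv : 0 < norm2 v.
    rewrite lt_def norm2_ge0 andbT; apply: contraNneq v0 => v0.
    by apply/eqP; apply: dot_eq0; rewrite -sqr_norm2 v0 expr0n.
  have Sv : S ((norm2 v)^-1 *: v)^T.
    rewrite /S /= trmxK dotZl dotC dotZl -sqr_norm2.
    by field; rewrite gt_eqF.
  have := cmin _ (mem_set Sv); rewrite /f trmxK -/x -/mu.
  have -> : quad A ((norm2 v)^-1 *: v) = quad A v / norm2 v ^+ 2.
    rewrite -[quad _ _]/(bil A _ _) bilZl bilZr -[quad A v]/(bil A v v).
    by field; rewrite gt_eqF.
  by rewrite ler_pdivlMr ?exprn_gt0// sqr_norm2.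
have dx : dot x x = 1 by [].
have x0 : x != 0.
  by apply/eqP => x0; move: dx; rewrite x0 /dot mulmx0 mxE => /eqP; rewrite eq_sym oner_eq0.
have mu0 : 0 < mu by exact: pA.
(* On a line through [x] the form [quad A] minus [mu] times the squared norm is nonnegative and
   vanishes at [x]. Its linear coefficient is therefore 0, which is the eigenvector equation tested
   against [v]. *)
have lin v : bil A x v = mu * dot x v.
  have := @linear_coef0 R (2 * (bil A x v - mu * dot x v)) (quad A v - mu * dot v v) 0 0.
  move=> /(_ _)/eqP; rewrite mulf_eq0 pnatr_eq0/= subr_eq0 => L.
  apply/eqP; apply: L => h; have := mumin (h *: v + x); rewrite -subr_ge0.
  congr (0 <= _); rewrite -!/(bil _ _ _) dotPl !dotPr -[quad A (_ + _)]/(bil A _ _).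
  rewrite bilPl !bilPr (bilC v x sA) (dotC v x) /mu -[quad A x]/(bil A x x) dx.
  by rewrite -[quad A v]/(bil A v v); ring.
have ev : eigenvalue A mu.
  apply/eigenvalueP; exists x^T; last by rewrite trmx_eq0.
  apply/rowP => i; have := lin (delta_mx i 0); rewrite /bil /dot.
  by rewrite -!colE !mxE.
have lb : lbound [set a : R | eigenvalue A a] mu.
  move=> a /= /eigenvalueP[v va v0].
  have := mumin v^T; have vv : 0 < dot v^T v^T.
    rewrite lt_def dot_ge0 andbT; apply/eqP => /dot_eq0/eqP; rewrite trmx_eq0.
    exact/negP.
  rewrite /quad trmxK va -scalemxAl mxE.
  by rewrite (_ : (v *m v^T) 0 0 = dot v^T v^T) ?ler_pM2r// /dot trmxK.
have -> : lambda_min A = mu.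
  apply/eqP; rewrite eq_le; apply/andP; split.
    by apply: ge_inf => //; exists mu.
  by apply: lb_le_inf => //; exists mu.
by split.
Qed.

End Rayleigh.

Lemma powR_three_halves (R : realType) (x : R) : 0 <= x ->
  x `^ (3 / 2) = Num.sqrt x ^+ 3.
Proof.
move=> x0; rewrite (_ : 3 / 2 = 2^-1 * 3%:R); last by field.
by rewrite powRrM powR12_sqrt// powR_mulrn// sqrtr_ge0.
Qed.

Section WeightedBounds.
Context {R : realType} {n : nat}.
Variable W : 'M[R]_n.
Hypotheses (sW : symmetric_mx W) (pW : pos_def W).
Implicit Types (A : 'M[R]_n) (u v w a b c : 'cV[R]_n).

Lemma ler_scaled_pM2 (K x y x' y' : R) : 0 <= K -> 0 <= x -> 0 <= y ->
  x <= x' -> y <= y' -> K * x * y <= K * x' * y'.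
Proof.
move=> K0 x0 y0 xx yy; apply: ler_pM => //; first exact: mulr_ge0.
exact: ler_wpM2l.
Qed.

Lemma ler_scaled_pM3 (K x y z x' y' z' : R) :
  0 <= K -> 0 <= x -> 0 <= y -> 0 <= z ->
  x <= x' -> y <= y' -> z <= z' -> K * x * y * z <= K * x' * y' * z'.
Proof.
move=> K0 x0 y0 z0 xx yy zz; apply: ler_pM => //; first by rewrite !mulr_ge0.
exact: ler_scaled_pM2.
Qed.

Lemma tri_diag (t : 'I_n -> R) a b c :
  tri (diag_tensor t) a b c = \sum_j t j * a j 0 * b j 0 * c j 0.
Proof.
rewrite /tri; apply: eq_bigr => i _; rewrite (bigD1 i)//= [X in _ + X]big1 ?addr0.
  rewrite (bigD1 i)//= [X in _ + X]big1 ?addr0 /diag_tensor ?eqxx// => k ki.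
  by rewrite (eq_sym i k) (negPf ki) andbF !mul0r.
move=> j ji; apply: big1 => k _.
by rewrite /diag_tensor (eq_sym i j) (negPf ji) !mul0r.
Qed.

Lemma norm2_normW_lambda v : (0 < n)%N ->
  Num.sqrt (lambda_min W) * norm2 v <= normW W v.
Proof.
move=> n0; have [l0 lP] := lambda_minP n0 sW pW.
rewrite /norm2 /normW -sqrtrM; last exact: ltW.
by apply: ler_wsqrtr.
Qed.

(** One factor is bounded by its norm and Cauchy-Schwarz handles the other two, so no power of the
    dimension appears. *)
Lemma sum_norm_mul3 a b c :
  \sum_j `|a j 0| * `|b j 0| * `|c j 0| <= norm2 a * norm2 b * norm2 c.
Proof.
pose ab (u : 'cV[R]_n) : 'cV[R]_n := \col_j `|u j 0|.
have nab u : norm2 (ab u) = norm2 u.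
  congr Num.sqrt; rewrite !dotE; apply: eq_bigr => j _.
  by rewrite !mxE -normrM ger0_norm// -expr2 sqr_ge0.
apply: le_trans (_ : \sum_j `|a j 0| * `|b j 0| * norm2 c <= _).
  by apply: ler_sum => j _; rewrite ler_wpM2l ?mulr_ge0// coord_norm2.
rewrite -mulr_suml ler_wpM2r ?norm2_ge0// -(nab a) -(nab b).
apply: le_trans (cauchy_schwarz _ _); rewrite dotE.
by apply: ler_sum => j _; rewrite !mxE.
Qed.

(** Replacing the Euclidean norm by the weighted one costs [lambda_min W] to the power -1/2 in each
    of the three arguments; this is the origin of the exponent -3/2. *)
Lemma diag_tensor_bound (t : 'I_n -> R) B a b c : 0 <= B ->
  (forall j, `|t j| * lambda_min W `^ (- (3 / 2)) <= B) ->
  `|tri (diag_tensor t) a b c| <= B * normW W a * normW W b * normW W c.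
Proof.
move=> B0 tB; have [n0|n0] := posnP n.
  rewrite tri_diag big1 ?normr0 => [|[j jn] _]; last first.
    by exfalso; move: jn; rewrite n0.
  by rewrite !mulr_ge0 ?normW_ge0.
have [l0 _] := lambda_minP n0 sW pW; set mu := Num.sqrt (lambda_min W).
have mu0 : 0 < mu by rewrite sqrtr_gt0.
have powE : lambda_min W `^ (- (3 / 2)) = (mu ^+ 3)^-1.
  by rewrite powRN powR_three_halves// ltW.
have tj j : `|t j| <= B * mu ^+ 3.
  by have := tB j; rewrite powE ler_pdivrMr// exprn_gt0.
rewrite tri_diag; apply: le_trans (ler_norm_sum _ _ _) _.
apply: le_trans (_ : \sum_j B * mu ^+ 3 * (`|a j 0| * `|b j 0| * `|c j 0|) <= _).
  apply: ler_sum => j _; rewrite !normrM -!(mulrA `|t j|) ler_wpM2r ?mulr_ge0//.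
rewrite -mulr_sumr.
apply: le_trans (_ : B * mu ^+ 3 * (norm2 a * norm2 b * norm2 c) <= _).
  by rewrite ler_wpM2l ?sum_norm_mul3// mulr_ge0// exprn_ge0 ?ltW.
rewrite (_ : B * mu ^+ 3 * _ =
  B * (mu * norm2 a) * (mu * norm2 b) * (mu * norm2 c)); last by ring.
have nn v : 0 <= mu * norm2 v by rewrite mulr_ge0 ?norm2_ge0// ltW.
have nW v := norm2_normW_lambda v n0.
by apply: ler_scaled_pM3; rewrite ?nn ?nW.
Qed.

Lemma norm2_le_normW : exists2 K, 0 <= K & forall v, norm2 v <= K * normW W v.
Proof.
have [n0|n0] := posnP n.
  exists 0 => // v; rewrite mul0r /norm2 dotE big1 ?sqrtr0// => -[j jn].
  by exfalso; move: jn; rewrite n0.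
have [l0 _] := lambda_minP n0 sW pW.
exists (Num.sqrt (lambda_min W))^-1 => [|v].
  by rewrite invr_ge0 sqrtr_ge0.
by rewrite ler_pdivlMl ?sqrtr_gt0// norm2_normW_lambda.
Qed.

Lemma normW_le_norm2 : exists2 K, 0 <= K & forall v, normW W v <= K * norm2 v.
Proof.
have [K K0 KP] := bil_bound W; exists (Num.sqrt K) => [|v]; first exact: sqrtr_ge0.
rewrite /normW -[X in _ <= _ * X]ger0_norm ?norm2_ge0// -sqrtr_sqr -sqrtrM//.
rewrite ler_wsqrtr// expr2 mulrA.
exact: le_trans (ler_norm _) (KP _ _).
Qed.

Lemma normW_dot_bound u : exists2 K, 0 <= K & forall v, `|dot u v| <= K * normW W v.
Proof.
have [k k0 kP] := norm2_le_normW; have [K K0 KP] := dot_bound u.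
exists (K * k) => [|v]; first exact: mulr_ge0.
by apply: le_trans (KP v) _; rewrite -mulrA ler_wpM2l.
Qed.

Lemma normW_bil_bound A : exists2 K, 0 <= K &
  forall u v, `|bil A u v| <= K * normW W u * normW W v.
Proof.
have [k k0 kP] := norm2_le_normW; have [K K0 KP] := bil_bound A.
exists (K * k * k) => [|u v]; first by rewrite !mulr_ge0.
apply: le_trans (KP u v) _.
rewrite [leRHS](_ : _ = K * (k * normW W u) * (k * normW W v)); last by ring.
by apply: ler_scaled_pM2; rewrite ?norm2_ge0 ?kP.
Qed.

Lemma normW_tri_bound (T : tensor3 R n) : exists2 K, 0 <= K &
  forall u v w, `|tri T u v w| <= K * normW W u * normW W v * normW W w.
Proof.
have [k k0 kP] := norm2_le_normW; have [K K0 KP] := tri_bound T.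
exists (K * k * k * k) => [|u v w]; first by rewrite !mulr_ge0.
apply: le_trans (KP u v w) _.
rewrite [leRHS](_ : _ = K * (k * normW W u) * (k * normW W v) * (k * normW W w)); last by ring.
by apply: ler_scaled_pM3; rewrite ?norm2_ge0 ?kP.
Qed.
End WeightedBounds.

(** * The initial level set and bounds on it *)

Section LevelSet.
Context {R : realType} {n : nat}.
Variables (f0 : R) (g : 'cV[R]_n) (H : 'M[R]_n) (T : tensor3 R n)
    (sigma : R) (W : 'M[R]_n).
Hypotheses (sH : symmetric_mx H) (sT : symmetric_tensor T) (sigma_gt0 : 0 < sigma)
  (sW : symmetric_mx W) (pW : pos_def W).
Local Notation m3 := (ar3_model f0 g H T sigma W).

Lemma ar3_model0 : m3 0 = f0.
Proof.
rewrite /ar3_model /dot /quad /cubic /normW /quad !mulmx0 !mxE sqrtr0 big1.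
  by rewrite expr0n /= !mulr0 !addr0.
by move=> i _; rewrite big1// => j _; rewrite big1// => k _; rewrite !mxE !mulr0.
Qed.

(** Beyond this radius [N > 1] bounds the lower-order terms by multiples of [N ^+ 3], and the
    quartic term exceeds their sum. As [m3] never increases along a run, bounds on this set hold at
    all iterates for all tolerances. *)
Lemma level_set_bounded : exists2 L, 0 < L & forall x, m3 x <= m3 0 -> normW W x <= L.
Proof.
have [a a0 aP] := normW_dot_bound sW pW g.
have [b b0 bP] := normW_bil_bound sW pW H.
have [c c0 cP] := normW_tri_bound sW pW T.
have Q0 : 0 <= 4 / sigma * (a + b + c).
  by rewrite mulr_ge0 ?addr_ge0// divr_ge0// ltW.
exists (1 + 4 / sigma * (a + b + c)) => [|x]; first by lra.
rewrite ar3_model0 /ar3_model => mx; rewrite leNgt; apply/negP => Nx.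
set N := normW W x in Nx mx *.
have N1 : 1 < N by lra.
have N0 : 0 <= N by lra.
have SN : 4 * (a + b + c) < sigma * N.
  have : 4 / sigma * (a + b + c) < N by lra.
  by rewrite -mulrA mulrCA ltr_pdivrMl// mulrC.
have g1 : - (a * N ^+ 3) <= dot g x.
  have := aP x; rewrite ler_norml => /andP[+ _]; apply: le_trans.
  rewrite lerN2 ler_wpM2l// -[leLHS]expr1 ler_eXn2l//.
have g2 : - (b * N ^+ 3) <= quad H x.
  have := bP x x; rewrite ler_norml => /andP[+ _]; apply: le_trans.
  by rewrite lerN2 -mulrA ler_wpM2l// -expr2 ler_eXn2l.
have g3 : - (c * N ^+ 3) <= cubic T x.
  have := cP x x x; rewrite ler_norml => /andP[+ _]; apply: le_trans.
  by rewrite lerN2 -!mulrA ler_wpM2l// -!exprS.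
have N3 : 0 < N ^+ 3 by rewrite exprn_gt0; lra.
have := ltr_pM2l N3 (4 * (a + b + c)) (sigma * N); rewrite SN => E.
have e4 : N ^+ 4 = N ^+ 3 * N by ring.
have := mulr_ge0 b0 (ltW N3); have := mulr_ge0 c0 (ltW N3).
move: mx E; rewrite e4; set P := N ^+ 3 in g1 g2 g3 N3 * => mx E.
nra.
Qed.

Lemma derivatives_bound L : 0 <= L ->
  exists2 K, 0 <= K & forall x, normW W x <= L ->
    (forall u v, `|hess_form H T sigma W x u v| <= K * normW W u * normW W v) /\
    (forall u v w, `|third_form T sigma W x u v w| <= K * normW W u * normW W v * normW W w).
Proof.
move=> L0.
have [b b0 bP] := normW_bil_bound sW pW H.
have [c c0 cP] := normW_tri_bound sW pW T.
have [k k0 kP] := normW_bil_bound sW pW W.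
have s0 := ltW sigma_gt0.
exists (b + c * L + 3 * sigma * (k * L) ^+ 2 + c + 6 * sigma * k * (k * L)) => [|x xL].
  by do !apply: addr_ge0 => //; rewrite ?mulr_ge0.
have N0 := @normW_ge0 R n W.
have kL u : `|bil W u x| <= k * L * normW W u.
  by apply: le_trans (kP u x) _; rewrite mulrAC ler_wpM2r// ler_wpM2l.
have kxx : `|bil W x x| <= k * L * L.
  by apply: le_trans (kL x) _; rewrite ler_wpM2l// mulr_ge0.
have absorb (a b' c' y : R) : 0 <= a -> 0 <= b' -> 0 <= c' -> 0 <= y ->
    a * y <= (a + b' + c') * y.
  by move=> a0 b0' c0' y0; rewrite ler_wpM2r// -addrA lerDl addr_ge0.
split=> [u v|u v w].
  apply: le_trans (_ : (b + c * L + 3 * sigma * (k * L) ^+ 2) *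
    (normW W u * normW W v) <= _); last first.
    rewrite -[leRHS]mulrA; apply: absorb; rewrite ?mulr_ge0//.
    by rewrite addr_ge0 ?mulr_ge0// addr_ge0 ?mulr_ge0.
  rewrite /hess_form [leRHS]mulrDl [X in _ <= X + _]mulrDl; apply: le_trans (ler_normD _ _) _; apply: lerD.
    apply: le_trans (ler_normD _ _) _; apply: lerD; first by rewrite mulrA.
    apply: le_trans (cP u v x) _.
    by rewrite [leRHS](_ : _ = c * normW W u * normW W v * L) ?ler_wpM2l ?mulr_ge0//; ring.
  rewrite normrM (ger0_norm s0).
  rewrite [leRHS](_ : _ = sigma * (3 * (k * L) ^+ 2 * (normW W u * normW W v))); last by ring.
  rewrite ler_wpM2l//.
  apply: le_trans (ler_normD _ _) _; rewrite !normrM normr_nat.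
  rewrite [leRHS](_ : _ = k * L * L * (k * normW W u * normW W v) +
     2 * (k * L * normW W u) * (k * L * normW W v)); last by ring.
  by rewrite lerD// ler_pM ?mulr_ge0// ler_pM.
apply: le_trans (_ : (c + 6 * sigma * k * (k * L)) *
    (normW W u * normW W v * normW W w) <= _); last first.
  rewrite -(mulrA (normW W u)) -[leRHS]mulrA -[leRHS]mulrA.
  rewrite ler_wpM2r ?mulr_ge0// lerD2r lerDr.
  by rewrite !addr_ge0 ?mulr_ge0// exprn_ge0// mulr_ge0.
rewrite /third_form [leRHS]mulrDl; apply: le_trans (ler_normD _ _) _; apply: lerD.
  by rewrite !mulrA.
rewrite !normrM normr_nat (ger0_norm s0).
rewrite [leRHS](_ : _ = 2 * sigma * (k * L * normW W u * (k * normW W v * normW W w) +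
     k * L * normW W v * (k * normW W u * normW W w) +
     k * L * normW W w * (k * normW W u * normW W v))); last by ring.
rewrite ler_wpM2l ?mulr_ge0//.
apply: le_trans (ler_normD _ _) _; apply: lerD; last by rewrite normrM ler_pM.
by apply: le_trans (ler_normD _ _) _; apply: lerD; rewrite normrM ler_pM.
Qed.

End LevelSet.

(** * One iteration of the algorithm *)

Section Iteration.
Context {R : realType} {n : nat}.
Variables (f0 : R) (g : 'cV[R]_n) (H : 'M[R]_n) (T : tensor3 R n)
    (sigma : R) (W : 'M[R]_n).
Hypotheses (sH : symmetric_mx H) (sT : symmetric_tensor T) (sigma_gt0 : 0 < sigma)
  (sW : symmetric_mx W) (pW : pos_def W).
Local Notation m3 := (ar3_model f0 g H T sigma W).
Local Notation D1 := (grad_form g H T sigma W).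
Local Notation D2 := (hess_form H T sigma W).
Local Notation D3 := (third_form T sigma W).

Lemma hess_formC x u v : D2 x u v = D2 x v u.
Proof.
by rewrite /hess_form (bilC u v sH) (triC12 u v x sT) (bilC u v sW); ring.
Qed.

(** The form is tested at the gradient itself. *)
Lemma norm2_grad_le x K : 0 <= K -> (forall v, `|D1 x v| <= K * norm2 v) ->
  norm2 (grad m3 x) <= K.
Proof.
move=> K0 KP; have [n0|n0] := leP (norm2 (grad m3 x)) 0; first exact: le_trans K0.
rewrite -(ler_pM2r n0) -expr2 sqr_norm2.
rewrite -[leLHS]ger0_norm ?dot_ge0//; apply: le_trans (KP _).
by rewrite dot_grad.
Qed.

Section OneIterate.
Variable (x : iterate R n).
Hypotheses (C_unit : it_C x \in unitmx) (d_ge0 : 0 <= it_d x).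
Let C := it_C x.
Let s := step x.
Let N := normW W s.
Let y0 := it_s x.
Let sd := sigma_d sigma x.
(** The cubic form of the model carried back to the original coordinates, so that both tensor rules
    are treated together and lengths are measured by [W]. *)
Let c u v w := tri (diag_tensor (it_t x)) (C *m u) (C *m v) (C *m w).

Lemma diag_tensor_sym (t : 'I_n -> R) : symmetric_tensor (diag_tensor t).
Proof.
move=> i j k; rewrite /diag_tensor; split.
  by rewrite (eq_sym j i); case: eqP => // ->.
by rewrite (eq_sym k j); case: (eqVneq j k) => [->|]; rewrite ?andbF.
Qed.

Lemma model_W_sym : symmetric_mx (model_W W x).
Proof. by rewrite /symmetric_mx /model_W !trmx_mul trmxK sW mulmxA. Qed.

Lemma quad_model_W u : quad (model_W W x) (C *m u) = quad W u.
Proof.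
rewrite /quad /model_W; congr (_ 0 0).
rewrite trmx_mul !mulmxA -(mulmxA (u^T)) -trmx_mul mulVmx//.
by rewrite trmx1 mulmx1 -!mulmxA mulKmx// mulmxA.
Qed.

Lemma model_W_pos : pos_def (model_W W x).
Proof.
move=> v v0; have vE : v = C *m (invmx C *m v) by rewrite mulKVmx.
rewrite vE quad_model_W; apply: pW; apply: contraNneq v0 => v0.
by rewrite vE v0 mulmx0.
Qed.

Lemma normW_model_W u : normW (model_W W x) (C *m u) = normW W u.
Proof. by rewrite /normW quad_model_W. Qed.

Lemma hatE : it_hat x = C *m s.
Proof. by rewrite /s /step mulKVmx. Qed.

Lemma step_normE : step_norm W x = N.
Proof. by rewrite /step_norm hatE normW_model_W. Qed.

(** The change of coordinates cancels from gradient, Hessian and weight; [C] survives only in the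
    cubic form [c]. *)
Lemma modelE u : model m3 sigma W x (C *m u) =
  m3 y0 + D1 y0 u + 1 / 2 * D2 y0 u u + 1 / 6 * c u u u + sd / 4 * bil W u u ^+ 2.
Proof.
rewrite /model {1}/ar3_model normW_model_W (exprM (normW W u) 2 2) sqr_normW//.
have -> : dot (model_g m3 x) (C *m u) = D1 y0 u.
  rewrite -(dot_grad f0 g sigma sH sT sW pW) /dot /model_g trmx_mul trmxK.
  by rewrite -!mulmxA mulKmx.
have -> // : quad (model_H m3 x) (C *m u) = D2 y0 u u.
rewrite -(hess_bil f0 g sigma sH sT sW pW) /quad /bil /model_H; congr (_ 0 0).
rewrite trmx_mul !mulmxA -(mulmxA (u^T)) -trmx_mul mulVmx//.
by rewrite trmx1 mulmx1 -!mulmxA mulKmx// mulmxA.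
Qed.

Lemma trialE v : D1 (trial x) v = D1 y0 v + D2 y0 v s
  + (D3 y0 v s s / 2 + sigma * bil W s s * bil W v s).
Proof.
rewrite /trial -/y0 -/s addrC -[s in D1 (s + _)]scale1r grad_form_line//.
by rewrite expr1n !mul1r.
Qed.

Lemma m3_trialE : m3 (trial x) =
  m3 y0 + D1 y0 s + D2 y0 s s / 2 + D3 y0 s s s / 6 + sigma / 4 * bil W s s ^+ 2.
Proof.
rewrite /trial -/y0 -/s addrC -[s in m3 (s + _)]scale1r model_line//.
by rewrite expr1n !mul1r !addrA.
Qed.

Lemma cP1 a u u' v w : c (a *: u + u') v w = a * c u v w + c u' v w.
Proof. by rewrite /c mulmxDr -scalemxAr triP1. Qed.

Lemma cC12 u v w : c u v w = c v u w.
Proof. exact: triC12 (diag_tensor_sym _). Qed.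

Lemma cC23 u v w : c u v w = c u w v.
Proof. exact: triC23 (diag_tensor_sym _). Qed.

Lemma cP2 a u v v' w : c u (a *: v + v') w = a * c u v w + c u v' w.
Proof. by rewrite cC12 cP1 !(cC12 _ u). Qed.

Lemma cP3 a u v w w' : c u v (a *: w + w') = a * c u v w + c u v w'.
Proof. by rewrite cC23 cP2 !(cC23 _ v). Qed.

Hypothesis (argmin : model_argmin m3 sigma W x).

Lemma argmin_step u : model m3 sigma W x (C *m s) <= model m3 sigma W x (C *m u).
Proof. by rewrite -hatE; exact: argmin. Qed.

Lemma stationary v :
  D1 y0 v + D2 y0 v s + 1 / 2 * c v s s + sd * bil W s s * bil W v s = 0.
Proof.
apply: (@linear_coef0 _ _ (1 / 2 * D2 y0 v v + 1 / 2 * c v v s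
  + sd / 4 * (2 * bil W s s * bil W v v + 4 * bil W v s ^+ 2))
  (1 / 6 * c v v v + sd * bil W v s * bil W v v) (sd / 4 * bil W v v ^+ 2)) => h.
have := argmin_step (h *: v + s); rewrite -subr_ge0 !modelE.
congr (0 <= _); rewrite !bilPl !bilPr grad_formP.
rewrite !cP1 !cP2 !cP3 hess_formP1 !hess_formP2//.
rewrite (hess_formC _ s v) (bilC s v sW) (cC12 s v v) (cC23 v s v) (cC12 s v s) (cC23 s s v) (cC12 s v s).
by field.
Qed.

(** The minimizer also minimizes the model on the ray through itself, so [quartic_ray_min] applies
    with [e = sd * N ^+ 4]. *)
Lemma decrease_ray : 0 < N ->
  (3 * (sd * N ^+ 4) + c s s s) ^+ 2 <=
  36 * (sd * N ^+ 4) * (m3 y0 - model m3 sigma W x (it_hat x)).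
Proof.
move=> N0; have sd0 : 0 < sd by rewrite /sd /sigma_d ltr_wpDr.
have N4 : bil W s s ^+ 2 = N ^+ 4 by rewrite -sqr_normW// -exprM.
rewrite hatE modelE N4.
rewrite [X in _ <= _ * X](_ : _ = - (D1 y0 s + D2 y0 s s / 2 + c s s s / 6 + sd * N ^+ 4 / 4)); last by field.
apply: quartic_ray_min => [|l]; first by rewrite mulr_gt0// exprn_gt0.
have := argmin_step (l *: s); rewrite -subr_ge0 !modelE -subr_ge0 => Hl.
rewrite -subr_ge0; apply: le_trans Hl _; rewrite le_eqVlt; apply/orP; left; apply/eqP.
rewrite (lin_scale _ _ (grad_formP _ _ _ _ _ y0)).
rewrite (lin_scale (l := D2 y0 ^~ (l *: s))); last by move=> *; exact: hess_formP1.
rewrite (lin_scale (l := D2 y0 s)); last by move=> *; exact: hess_formP2.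
rewrite (lin_scale (l := fun u => c u (l *: s) (l *: s))); last by move=> *; exact: cP1.
rewrite (lin_scale (l := fun u => c s u (l *: s))); last by move=> *; exact: cP2.
rewrite (lin_scale (l := fun u => c s s u)); last by move=> *; exact: cP3.
by rewrite bilZl bilZr !exprMn N4; field.
Qed.

End OneIterate.
End Iteration.

(* [y] stands for [sigma_d * ||s||_W]; the disjuncts are the cases (a), (b), (c)
   of the acceptance test, multiplied by [||s||_W]. *)
Lemma acceptance_bound (R : realFieldType) (al b y : R) : 0 < al -> 0 < y ->
  [|| al <= b,
      (b <= - (4 * al)) &&
        ~~ ((1 / 6 * (- b + al) <= y) && (y <= 2 / 3 * (- b + al)))
    | (- (4 * al) <= b <= al) && (2 / 3 * (- b + al) <= y)] ->
  9 / 5 * al * y <= (3 * y + b) ^+ 2.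
Proof.
move=> al0 y0; have ay : 0 < al * y by rewrite mulr_gt0.
have hi z : 0 <= z -> z <= 3 * y + b -> z ^+ 2 <= (3 * y + b) ^+ 2.
  by move=> z0 zy; rewrite ler_sqr ?nnegrE//; lra.
(* Here [3 * y + b >= 3 / 2 * y + al], and the square of the right side is at least [6 * al * y]. *)
have large : 2 / 3 * (- b + al) <= y -> 9 / 5 * al * y <= (3 * y + b) ^+ 2.
  move=> h; have : (3 / 2 * y + al) ^+ 2 <= (3 * y + b) ^+ 2 by apply: hi; lra.
  by apply: le_trans; have := sqr_ge0 (3 / 2 * y - al); nra.
case/or3P=> [ab|/andP[b4 /nandP[]]|/andP[_ /large //]].
- have := sqr_ge0 (3 * y - b); have : al * y <= b * y by rewrite ler_wpM2r// ltW.
  nra.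
(* Below the interval, [al <= - b / 4] gives [y <= 5 / 24 * - b], so [3 * y + b] is negative, of
   absolute value at least [3 / 8 * - b]. *)
- rewrite -ltNge => yb.
  have : (3 / 8 * - b) ^+ 2 <= (3 * y + b) ^+ 2.
    by rewrite -[leRHS]sqrrN ler_sqr ?nnegrE; lra.
  apply: le_trans.
  have yb' : y <= 5 / 24 * - b by lra.
  have : al * y <= - b / 4 * (5 / 24 * - b) by apply: ler_pM; lra.
  nra.
- by rewrite -ltNge => /ltW/large.
Qed.

Section IterationFacts.
Context {R : realType} {n : nat}.
Variables (f0 : R) (g : 'cV[R]_n) (H : 'M[R]_n) (T : tensor3 R n)
    (sigma : R) (W : 'M[R]_n).
Hypotheses (sH : symmetric_mx H) (sT : symmetric_tensor T) (sigma_gt0 : 0 < sigma)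
  (sW : symmetric_mx W) (pW : pos_def W).
Variables (B alpha eta : R).
Hypotheses (B_gt0 : 0 < B) (alpha_gt0 : 0 < alpha) (eta_gt0 : 0 < eta) (eta_le1 : eta <= 1).
Local Notation m3 := (ar3_model f0 g H T sigma W).
Local Notation D1 := (grad_form g H T sigma W).
Local Notation D2 := (hess_form H T sigma W).
Local Notation D3 := (third_form T sigma W).

Definition admissible (x : iterate R n) :=
  [/\ it_C x \in unitmx, 0 <= it_d x, model_argmin m3 sigma W x
    & forall j, `|it_t x j| * lambda_min (model_W W x) `^ (- (3 / 2)) <= B].

Section OneAdmissible.
Variables (x : iterate R n) (K : R).
Hypotheses (ax : admissible x) (K_ge0 : 0 <= K).
Let y0 := it_s x.
Let s := step x.
Let N := normW W s.
Hypothesis KP : forall u v w, `|D3 y0 u v w| <= K * normW W u * normW W v * normW W w.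
Let c u v w := tri (diag_tensor (it_t x)) (it_C x *m u) (it_C x *m v) (it_C x *m w).
Let sd := sigma_d sigma x.
Let Dec := m3 y0 - model m3 sigma W x (it_hat x).

Lemma c_bound u v w : `|c u v w| <= B * normW W u * normW W v * normW W w.
Proof.
have [Cu _ _ tB] := ax; rewrite -!(normW_model_W W Cu); apply: diag_tensor_bound tB.
- exact: model_W_sym.
- exact: model_W_pos.
- exact: ltW.
Qed.

(** Subtracting the stationarity of the model from the expansion of the gradient at the trial point
    cancels the first and second derivatives and the [sigma] part. What is left is the error in the
    third derivative and the penalty [d]. *)
Lemma grad_trial_le kW Lam : 0 <= kW -> 0 <= Lam ->
  (forall u v, `|bil W u v| <= kW * normW W u * normW W v) ->
  (forall v, normW W v <= Lam * norm2 v) ->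
  norm2 (grad m3 (trial x)) <=
    ((K + B) / 2 * N ^+ 2 + kW * it_d x * N ^+ 3) * Lam.
Proof.
move=> k0 L0 kP LP; have [Cu d0 am tB] := ax.
have N0 : 0 <= N := normW_ge0 W s.
have Q0 : 0 <= (K + B) / 2 * N ^+ 2 + kW * it_d x * N ^+ 3.
  have : 0 <= K + B by rewrite addr_ge0// ltW.
  by move=> KB; rewrite addr_ge0 ?mulr_ge0 ?exprn_ge0// divr_ge0.
apply: norm2_grad_le => // [|v]; first exact: mulr_ge0.
have := stationary sH sT sW pW Cu am v; rewrite -/y0 -/s => St.
have -> : D1 (trial x) v = (D3 y0 v s s - c v s s) / 2 - it_d x * N ^+ 2 * bil W v s.
  rewrite trialE// -/y0 -/s -[LHS]subr0 -{}St sqr_normW// /sigma_d -/(c v s s).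
  by field.
apply: (@le_trans _ _ (((K + B) / 2 * N ^+ 2 + kW * it_d x * N ^+ 3) * normW W v)); last first.
  by rewrite -[leRHS]mulrA ler_wpM2l.
have a1 : `|(D3 y0 v s s - c v s s) / 2| <= (K + B) / 2 * N ^+ 2 * normW W v.
  rewrite normrM [X in _ * X]ger0_norm//.
  rewrite [leRHS](_ : _ = (K * normW W v * N * N + B * normW W v * N * N) / 2); last by field.
  rewrite ler_wpM2r//; apply: le_trans (ler_normB _ _) _.
  exact: lerD (KP _ _ _) (c_bound _ _ _).
have a2 : `|it_d x * N ^+ 2 * bil W v s| <= kW * it_d x * N ^+ 3 * normW W v.
  rewrite normrM ger0_norm ?mulr_ge0 ?exprn_ge0//.
  rewrite [leRHS](_ : _ = it_d x * N ^+ 2 * (kW * normW W v * N)); last by ring.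
  by rewrite ler_wpM2l ?mulr_ge0 ?exprn_ge0.
by apply: le_trans (ler_normB _ _) _; rewrite [leRHS]mulrDl lerD.
Qed.

Lemma Dec_ge0 : 0 <= Dec.
Proof.
have [_ _ am _] := ax; rewrite subr_ge0; apply: le_trans (am 0) _.
by rewrite /model ar3_model0.
Qed.

Lemma beta_scale : 0 < N -> c s s s = beta W x * N ^+ 3.
Proof.
have [Cu _ _ _] := ax => N0.
rewrite /beta step_normE// -/s -/N hatE// -/s.
rewrite -[cubic _ _]/(tri _ _ _ _) !tri_diag /c tri_diag mulr_suml.
by apply: eq_bigr => j _; rewrite !mxE; field; rewrite gt_eqF.
Qed.

Lemma beta_bound : 0 < N -> `|beta W x| <= B.
Proof.
move=> N0; have := c_bound s s s; rewrite beta_scale// normrM.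
rewrite (ger0_norm (exprn_ge0 _ (ltW N0))) -/N.
by rewrite -!mulrA -!expr2 -exprS ler_pM2r// exprn_gt0.
Qed.

Lemma decrease_bound : 0 < N ->
  N ^+ 3 * (3 * (sd * N) + beta W x) ^+ 2 <= 36 * (sd * N) * Dec.
Proof.
move=> N0; have [Cu d0 am _] := ax.
have := decrease_ray sH sT sigma_gt0 sW pW Cu d0 am N0.
rewrite -/s -/N -/(c s s s) beta_scale// -/Dec -/sd.
have N3 : 0 < N ^+ 3 by rewrite exprn_gt0.
rewrite (exprS N 3) => E; rewrite -(ler_pM2l N3).
rewrite [leRHS](_ : _ = 36 * (sd * (N * N ^+ 3)) * Dec); last by ring.
by apply: le_trans E; rewrite le_eqVlt; apply/orP; left; apply/eqP; ring.
Qed.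

Lemma sd_gt0 : 0 < sd.
Proof. by have [_ d0 _ _] := ax; rewrite /sd /sigma_d ltr_wpDr. Qed.

Lemma thresholdE k : 0 < N ->
  (k * case_threshold W alpha x <= sd) = (k * (- beta W x + alpha) <= sd * N).
Proof.
have [Cu _ _ _] := ax => N0.
by rewrite /case_threshold step_normE// -/s -/N mulrA ler_pdivrMr.
Qed.

Lemma thresholdE' k : 0 < N ->
  (sd <= k * case_threshold W alpha x) = (sd * N <= k * (- beta W x + alpha)).
Proof.
have [Cu _ _ _] := ax => N0.
by rewrite /case_threshold step_normE// -/s -/N mulrA ler_pdivlMr.
Qed.

Lemma successful_decrease : successful m3 sigma W alpha eta x ->
  eta * (alpha / 20) * N ^+ 3 <= m3 y0 - m3 (trial x).
Proof.
move=> /andP[rho_ge cases]; have D0 := Dec_ge0.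
(* Division by 0 gives 0, so [eta <= rho] excludes [Dec = 0]. *)
have Dp : 0 < Dec.
  rewrite lt_def D0 andbT; apply: contraL rho_ge => /eqP DE.
  by rewrite -ltNge /rho -/y0 -/Dec DE invr0 mulr0.
have : eta * Dec <= m3 y0 - m3 (trial x) by rewrite -ler_pdivlMr.
apply: le_trans; rewrite -mulrA ler_wpM2l ?(ltW eta_gt0)//.
have := normW_ge0 W s; rewrite -/N le_eqVlt => /predU1P[<-|N0].
  by rewrite expr0n /= mulr0.
have sN : 0 < sd * N by rewrite mulr_gt0 ?sd_gt0.
rewrite -(ler_pM2l (_ : 0 < 36 * (sd * N))); last by rewrite mulr_gt0.
apply: le_trans (decrease_bound N0).
(* The [9 / 5] of [acceptance_bound] over the 36 of [decrease_bound] gives [alpha / 20]. *)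
rewrite [leLHS](_ : _ = N ^+ 3 * (9 / 5 * alpha * (sd * N))); last by field.
rewrite ler_wpM2l ?exprn_ge0 ?(ltW N0)//; apply: acceptance_bound => //.
by move: cases; rewrite !in_itv /= -/sd !thresholdE// thresholdE'.
Qed.

(** The extra term [d / 4 * N ^+ 4] outweighs the error [(K + B) / 6 * N ^+ 3] of the cubic terms,
    so the model overestimates [m3] at the trial point and [rho] is at least 1. As [beta] is at most
    [B] in absolute value, [sd * N] also exceeds the upper threshold of cases (b) and (c). *)
Lemma large_penalty_successful : 0 < N -> K + B + alpha <= it_d x * N ->
  successful m3 sigma W alpha eta x.
Proof.
move=> N0 dN; have [Cu d0 am tB] := ax.
have K0 := K_ge0; have B0 := B_gt0; have a0 := alpha_gt0.
have yd : it_d x * N < sd * N by rewrite ltr_pM2r// /sd /sigma_d ltrDr.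
have := beta_bound N0; rewrite ler_norml => /andP[b1 b2].
have Dp : 0 < Dec.
  have sN : 0 < 36 * (sd * N) by rewrite !mulr_gt0 ?sd_gt0.
  rewrite -(pmulr_rgt0 _ sN); apply: lt_le_trans (decrease_bound N0).
  have pos : 0 < 3 * (sd * N) + beta W x.
    lra.
  by rewrite mulr_gt0 ?exprn_gt0.
apply/andP; split.
  rewrite ler_pdivlMr//; apply: le_trans (_ : Dec <= _).
    by rewrite ger_pMl.
  rewrite /Dec lerB// m3_trialE// hatE// modelE// -/y0 -/s -/(c s s s) -sqr_normW//.
  have := KP s s s; have := c_bound s s s; rewrite -/N !ler_norml.
  move=> /andP[c1 _] /andP[_ k1].
  have N3 : 0 < N ^+ 3 by rewrite exprn_gt0.
  have KB := ler_wpM2l (ltW N3) dN.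
  have K3 : 0 <= K * N ^+ 3 by rewrite mulr_ge0 // ltW.
  have A3 : 0 < alpha * N ^+ 3 by rewrite mulr_gt0.
  have B3 : 0 < B * N ^+ 3 by rewrite mulr_gt0.
  rewrite /sigma_d (_ : (N ^+ 2) ^+ 2 = N ^+ 3 * N); last by ring.
  rewrite (_ : B * N * N * N = B * N ^+ 3) in c1; last by ring.
  rewrite (_ : K * N * N * N = K * N ^+ 3) in k1; last by ring.
  move: (N ^+ 3) c1 k1 KB K3 A3 B3 => P c1 k1 KB K3 A3 B3.
  lra.
rewrite !in_itv /= -/sd !thresholdE// thresholdE'//.
have [//|ba /=] := leP alpha (beta W x).
have big : 2 / 3 * (- beta W x + alpha) < sd * N by lra.
have [b4|b4] := leP (beta W x) (- (4 * alpha)).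
  by rewrite (lt_geF big) andbF.
by rewrite (ltW b4) (ltW ba) (ltW big).
Qed.
End OneAdmissible.
End IterationFacts.

(** * Counting iterations *)

Section LowGradient.
Context {R : realType} {n : nat}.
Variables (f0 : R) (g : 'cV[R]_n) (H : 'M[R]_n) (T : tensor3 R n)
    (sigma : R) (W : 'M[R]_n).
Hypotheses (sH : symmetric_mx H) (sT : symmetric_tensor T) (sigma_gt0 : 0 < sigma)
  (sW : symmetric_mx W) (pW : pos_def W).
Local Notation m3 := (ar3_model f0 g H T sigma W).
Local Notation D1 := (grad_form g H T sigma W).
Local Notation D2 := (hess_form H T sigma W).
Local Notation D3 := (third_form T sigma W).

(** Squares make the conditions polynomial. [v] and [t] are variables of the formula, so one count
    serves every gradient bound; the last condition gives compactness. *)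
Let low (L v t : R) (x : nat -> R) :=
  [/\ m3 (vec 0 x) = v, \sum_i D1 (vec 0 x) (basis_vec i) ^+ 2 <= t ^+ 2
    & bil W (vec 0 x) (vec 0 x) <= L ^+ 2].

Lemma polyfun_m3 o : polyfun (fun e => m3 (vec o e)).
Proof.
have pv := @polyvec_vec R n o.
apply: (@polyfun_ext _ (fun e => f0 + dot g (vec o e) + 1 / 2 * bil H (vec o e) (vec o e)
   + 1 / 6 * tri T (vec o e) (vec o e) (vec o e)
   + sigma / 4 * bil W (vec o e) (vec o e) ^+ 2)) => [e|].
  by rewrite /ar3_model (exprM (normW _ _) 2 2) sqr_normW.
repeat apply: polyfunD; try exact: polyfun_const.
- by apply: polyfun_dot => //; exact: polyvec_const.
- by apply: polyfunM; [exact: polyfun_const|exact: polyfun_bil].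
- by apply: polyfunM; [exact: polyfun_const|exact: polyfun_tri].
- apply: polyfunM; [exact: polyfun_const|apply: polyfunX; exact: polyfun_bil].
Qed.

Lemma polyfun_D1 o u : polyfun (fun e => D1 (vec o e) u).
Proof.
have pv := @polyvec_vec R n o; have pu := polyvec_const u.
rewrite /grad_form; repeat apply: polyfunD.
- by apply: polyfun_dot => //; exact: polyvec_const.
- exact: polyfun_bil.
- by apply: polyfunM; [exact: polyfun_const|exact: polyfun_tri].
- apply: polyfunM; last exact: polyfun_bil.
  by apply: polyfunM; [exact: polyfun_const|exact: polyfun_bil].
Qed.

Lemma polyfun_sqr_grad o :
  polyfun (fun e => \sum_i D1 (vec o e) (basis_vec i) ^+ 2).
Proof. by apply: polyfun_sum => i; apply: polyfunX; exact: polyfun_D1. Qed.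

Let low_def L o : definable (fun e => low L (e 0%N) (e 1%N) (fun i => e (o + i)%N)).
Proof.
have pb := polyfun_bil W (@polyvec_vec R n o) (@polyvec_vec R n o).
apply: definable_ext (definable_and (definable_and
  (definable_eq (polyfun_m3 o) (polyfun_var R 0%N))
  (definable_le (polyfun_sqr_grad o) (polyfunX 2 (polyfun_var R 1%N))))
  (definable_le pb (polyfun_const (L ^+ 2)))) => e.
by split=> [[[? ?] ?]|[? ? ?]].
Qed.

Let vec_agree (x z : nat -> R) : agree n x z -> vec 0 x = vec 0 z :> 'cV[R]_n.
Proof. by move=> xz; apply/colP => i; rewrite !mxE; apply: xz; exact: ltn_ord. Qed.

Lemma sqr_grad x : \sum_i D1 x (basis_vec i) ^+ 2 = norm2 (grad m3 x) ^+ 2.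
Proof.
rewrite sqr_norm2 dotE; apply: eq_bigr => i _.
by rewrite mxE partial1E.
Qed.

Lemma norm2_le_sum (w : 'cV[R]_n) d : (forall i, `|w i 0| <= d) -> 0 <= d ->
  norm2 w <= n%:R * d.
Proof.
move=> wd d0; rewrite -(ler_pXn2r (_ : (0 < 2)%N)) ?nnegrE ?norm2_ge0 ?mulr_ge0//.
rewrite sqr_norm2 dotE.
apply: le_trans (_ : \sum_(i < n) d ^+ 2 <= _).
  apply: ler_sum => i _; rewrite -expr2 -[leLHS]ger0_norm ?sqr_ge0// normrX.
  by rewrite ler_pXn2r ?nnegrE.
rewrite sumr_const card_ord -[leLHS]mulr_natl exprMn ler_wpM2r ?sqr_ge0//.
by rewrite -natrX ler_nat expnS expn1; case: (n) => // k; rewrite leq_pmulr.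
Qed.

(** The gradient at [y] controls the linear term; the higher ones are absorbed into [P ^+ 2] because
    [P <= 1]. *)
Lemma low_gradient_variation L : 0 <= L ->
  exists2 C, 0 <= C & forall y w h P,
    normW W y <= L -> norm2 (grad m3 y) <= h -> 0 <= P -> P <= 1 ->
    norm2 w <= P -> m3 (w + y) - m3 y <= h * P + C * P ^+ 2.
Proof.
move=> L0; have [K K0 KP] := derivatives_bound H T sigma_gt0 sW pW L0.
have [Lam Lam0 LP] := normW_le_norm2 W.
exists (K * Lam ^+ 2 + K * Lam ^+ 3 + sigma * Lam ^+ 4) => [|y w h P yL gh P0 P1 wP].
  by rewrite !addr_ge0 ?mulr_ge0 ?exprn_ge0// ltW.
have [/(_ w w) K2 /(_ w w w) K3] := KP y yL.
rewrite -[X in m3 (X + _)]scale1r model_line// expr1n !mul1r.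
have NwP : normW W w <= Lam * P.
  by apply: le_trans (LP w) _; rewrite ler_wpM2l.
have N0 := normW_ge0 W w.
have d1 : D1 y w <= h * P.
  rewrite -(dot_grad f0 g sigma sH sT sW pW); apply: le_trans (cauchy_schwarz _ _) _.
  by rewrite ler_pM ?norm2_ge0.
have P2 : 0 <= P ^+ 2 by rewrite sqr_ge0.
have Nk k : (2 <= k)%N -> normW W w ^+ k <= Lam ^+ k * P ^+ 2.
  move=> k2; apply: le_trans (_ : (Lam * P) ^+ k <= _).
    by apply: lerXn2r; rewrite ?nnegrE ?mulr_ge0.
  by rewrite exprMn ler_wpM2l ?exprn_ge0// ler_wiXn2l.
have d2 : D2 y w w <= K * (Lam ^+ 2 * P ^+ 2).
  apply: le_trans (ler_norm _) _; apply: le_trans K2 _.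
  by rewrite -mulrA -expr2 ler_wpM2l ?Nk.
have d3 : D3 y w w w <= K * (Lam ^+ 3 * P ^+ 2).
  apply: le_trans (ler_norm _) _; apply: le_trans K3 _.
  rewrite [leLHS](_ : _ = K * normW W w ^+ 3); last by ring.
  by apply: ler_wpM2l => //; exact: Nk.
have d4 : sigma * bil W w w ^+ 2 <= sigma * (Lam ^+ 4 * P ^+ 2).
  rewrite ler_wpM2l ?(ltW sigma_gt0)// -sqr_normW// -exprM.
  exact: Nk.
have e2 : 0 <= K * (Lam ^+ 2 * P ^+ 2) by rewrite !mulr_ge0 ?exprn_ge0.
have e3 : 0 <= K * (Lam ^+ 3 * P ^+ 2) by rewrite !mulr_ge0 ?exprn_ge0.
have e4 : 0 <= sigma * (Lam ^+ 4 * P ^+ 2) by rewrite !mulr_ge0 ?exprn_ge0 ?(ltW sigma_gt0).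
rewrite [X in _ <= _ + X](_ : _ = K * (Lam ^+ 2 * P ^+ 2) + K * (Lam ^+ 3 * P ^+ 2)
  + sigma * (Lam ^+ 4 * P ^+ 2)); last by ring.
lra.
Qed.

(* Decreasing values of [m3] at points of gradient at most [h] are also taken by
   the selection; a gap [c0 h ^+ 3] forces it to jump by [a h ^+ 2], as a move of
   length [P] changes [m3] by at most [h P + C P ^+ 2]. *)
Lemma few_low_gradient_values c0 : 0 < c0 -> exists2 M, 0 < M &
  forall h N (x : nat -> 'cV[R]_n), 0 < h -> h <= 1 ->
    (forall j, (j <= N)%N -> m3 (x j) <= m3 0 /\ norm2 (grad m3 (x j)) <= h) ->
    (forall j, (j < N)%N -> m3 (x j.+1) + c0 * h ^+ 3 <= m3 (x j)) ->
    N%:R * h ^+ 2 <= M.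
Proof.
move=> c00; have [L L0 Lev] := level_set_bounded f0 g H T sigma_gt0 sW pW.
have [k k0 kP] := norm2_le_normW sW pW.
have [C C0 Var] := low_gradient_variation (ltW L0).
have low_agree v t x z : agree n x z -> low L v t x -> low L v t z.
  by move=> /vec_agree xz; rewrite /low xz.
have low_bound v t x : low L v t x -> forall i, (i < n)%N -> `|x i| <= k * L.
  move=> [_ _ xL] i im; have := coord_norm2 (vec 0 x : 'cV_n) (Ordinal im).
  rewrite mxE /= => /le_trans; apply; apply: le_trans (kP _) _.
  rewrite ler_wpM2l// -(ler_pXn2r (_ : (0 < 2)%N)) ?nnegrE ?normW_ge0 ?(ltW L0)//.
  by rewrite sqr_normW.
have low_compact v t : compact [set u : 'rV[R]_n | low L v t (coords u)].
  apply: (@compact_coord_bound _ _ _ (k * L)); last first.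
    by move=> u /= Du i; rewrite -coords_ord; exact: (low_bound _ _ _ Du).
  have -> : [set u : 'rV[R]_n | low L v t (coords u)] =
      [set u : 'rV[R]_n | (fun e => m3 (vec 0 e)) (coords u) = v] `&`
      [set u : 'rV[R]_n | (fun e => \sum_i D1 (vec 0 e) (basis_vec i) ^+ 2) (coords u) <= t ^+ 2] `&`
      [set u : 'rV[R]_n | (fun e => bil W (vec 0 e) (vec 0 e)) (coords u) <= L ^+ 2].
    by apply/seteqP; split=> u /= => [[? ? ?]|[[? ?] ?]].
  apply: closedI; first apply: closedI.
  - exact: (@closed_polyfun_eq R n _ v (polyfun_m3 0)).
  - exact: (@closed_polyfun_le R n _ (t ^+ 2) (polyfun_sqr_grad 0)).
  - exact: (@closed_polyfun_le R n _ (L ^+ 2) (polyfun_bil W (polyvec_vec 0) (polyvec_vec 0))).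
have [sel [Mn [selP cnt]]] := definable_selection (low_def L) low_agree low_compact low_bound.
(* Chosen such that [n * a * (1 + C) < c0] and [n * a <= 1]: a move of at most [d] in every
   coordinate has length at most [n * d] and raises [m3] by less than [c0 * h ^+ 3]. *)
pose a := c0 / ((1 + C + c0) * n.+1%:R).
have a0 : 0 < a by rewrite divr_gt0// mulr_gt0 ?ltr0n//; lra.
have kL0 : 0 <= 2 * (k * L) by rewrite !mulr_ge0// ltW.
have Q0 : 0 <= n%:R * Mn%:R * (2 * (k * L) / a + 2).
  by rewrite mulr_ge0 ?mulr_ge0 ?ler0n// addr_ge0// divr_ge0// ltW.
exists (1 + n%:R * Mn%:R * (2 * (k * L) / a + 2)); first by rewrite ltr_pwDl.
move=> h N x h0 h1 xlow gap; pose v j := m3 (x j); pose d := a * h ^+ 2.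
have d0 : 0 < d by rewrite mulr_gt0 ?exprn_gt0.
have dec j : (j < N)%N -> v j.+1 < v j.
  move=> jN; apply: lt_le_trans (gap j jN); rewrite ltrDl.
  by rewrite mulr_gt0 ?exprn_gt0.
have Dx j : (j <= N)%N -> exists z, low L (v j) h z.
  move=> jN; have [lx gx] := xlow j jN; exists (fun i => oapp (x j ^~ 0) 0 (insub i)).
  have zE : vec 0 (fun i => oapp (x j ^~ 0) 0 (insub i)) = x j.
    by apply/colP => i; rewrite mxE add0n valK.
  rewrite /low zE; split=> //.
    by rewrite sqr_grad lerXn2r ?nnegrE ?norm2_ge0 ?(ltW h0).
  rewrite -sqr_normW//; apply: lerXn2r; rewrite ?nnegrE ?normW_ge0 ?(ltW L0)//.
  exact: Lev.
pose z j : 'cV[R]_n := vec 0 (sel (v j) h).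
have zlow j : (j <= N)%N -> low L (v j) h (sel (v j) h).
  by move=> jN; have [y Dy] := Dx j jN; exact: selP Dy.
have jump j : (j < N)%N -> exists i : 'I_n, d <= `|sel (v j) h i - sel (v j.+1) h i|.
  move=> jN; apply/not_existsP => nojump.
  have [zj _ _] := zlow j (ltnW jN); have [zj1 gj1 Lj1] := zlow j.+1 jN.
  pose w := z j - z j.+1.
  have wd i : `|w i 0| <= d.
    rewrite !mxE add0n; apply: ltW; rewrite ltNge; apply/negP; exact: nojump.
  have wn := norm2_le_sum wd (ltW d0).
  have yL : normW W (z j.+1) <= L.
    rewrite -(ler_pXn2r (_ : (0 < 2)%N)) ?nnegrE ?normW_ge0 ?(ltW L0)//.
    by rewrite sqr_normW.
  have gh : norm2 (grad m3 (z j.+1)) <= h.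
    rewrite -(ler_pXn2r (_ : (0 < 2)%N)) ?nnegrE ?norm2_ge0 ?(ltW h0)//.
    by rewrite -sqr_grad.
  have n1 : 0 < n.+1%:R :> R by rewrite ltr0n.
  have na : n%:R * a * (1 + C) < c0 /\ n%:R * a <= 1.
    have aE : n.+1%:R * a * (1 + C + c0) = c0.
      rewrite /a; field; rewrite !gt_eqF//; lra.
    have nn : n%:R * a <= n.+1%:R * a by rewrite ler_wpM2r ?(ltW a0)// ler_nat.
    have na0 : 0 <= n%:R * a by rewrite mulr_ge0 ?(ltW a0).
    have na1 : 0 < n.+1%:R * a by rewrite mulr_gt0.
    move: aE nn na0 na1; move: (n%:R * a) (n.+1%:R * a) => p q aE pq p0 q0.
    by split; nra.
  have P0 : 0 <= n%:R * d by rewrite mulr_ge0 ?(ltW d0).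
  have PE : n%:R * d = n%:R * a * h ^+ 2 by rewrite mulrA.
  have h2 : h ^+ 2 <= 1 by apply: exprn_ile1 => //; exact: ltW.
  have h20 : 0 < h ^+ 2 by rewrite exprn_gt0.
  have [na1 na2] := na.
  have na0 : 0 <= n%:R * a by rewrite mulr_ge0 ?(ltW a0).
  have P1 : n%:R * d <= 1 by rewrite PE; nra.
  have := Var (z j.+1) w h _ yL gh P0 P1 wn.
  rewrite /w subrK /z zj zj1 PE => V.
  have := gap j jN; rewrite -/(v j) -/(v j.+1) => G.
  have : c0 * h ^+ 3 <= h * (n%:R * a * h ^+ 2) + C * (n%:R * a * h ^+ 2) ^+ 2 by lra.
  have : (n%:R * a * h ^+ 2) ^+ 2 <= n%:R * a * h ^+ 3.
    rewrite [leLHS](_ : _ = n%:R * a * h ^+ 3 * (n%:R * a * h)); last by ring.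
    apply: ler_piMr; first by rewrite mulr_ge0// exprn_ge0// ltW.
    by apply: le_trans na2; exact: ler_piMr.
  move=> /(ler_wpM2l C0).
  have : n%:R * a * (1 + C) * h ^+ 3 < c0 * h ^+ 3 by rewrite ltr_pM2r ?exprn_gt0.
  move: (n%:R * a) => p; rewrite (_ : h * (p * h ^+ 2) = p * h ^+ 3); last by ring.
  move: (h ^+ 3) ((p * h ^+ 2) ^+ 2) => q r ? ? ?; lra.
(* Some coordinate jumps at each of the [N] steps, and [cnt] bounds the jumps of each coordinate. *)
have Ncount : (N <= n * (Mn * (Num.truncn (2 * (k * L) / d)).+2))%N.
  apply: leq_trans (_ : \sum_(j < N) \sum_(i < n)
     (d <= `|sel (v j) h i - sel (v j.+1) h i|)%R <= _)%N.
    rewrite -[leqLHS]card_ord -sum1_card; apply: leq_sum => j _.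
    by have [i di] := jump j (ltn_ord j); rewrite (bigD1 i)//= di.
  rewrite exchange_big /= -[X in (_ <= X * _)%N]card_ord -sum_nat_const.
  by apply: leq_sum => i _; exact: cnt.
have tr : (Num.truncn (2 * (k * L) / d))%:R <= 2 * (k * L) / d.
  have r0 : 0 <= 2 * (k * L) / d by rewrite divr_ge0// ltW.
  by have /andP[] := truncn_itv r0.
apply: le_trans (_ : (n * (Mn * (Num.truncn (2 * (k * L) / d)).+2))%:R * h ^+ 2 <= _).
  by rewrite ler_wpM2r ?ler_nat// exprn_ge0// ltW.
rewrite !natrM mulrA -mulrA; apply: le_trans (_ : n%:R * Mn%:R * (2 * (k * L) / a + 2) <= _).
  rewrite ler_wpM2l ?mulr_ge0 ?ler0n//.
  rewrite -addn2 natrD mulrDl; apply: lerD.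
    apply: le_trans (ler_wpM2r _ tr) _; first by rewrite exprn_ge0 ?(ltW h0).
    by rewrite /d le_eqVlt; apply/orP; left; apply/eqP; field; rewrite !gt_eqF.
  by rewrite ger_pMr ?exprn_ile1 ?(ltW h0).
by rewrite lerDr.
Qed.
End LowGradient.

(** * Step length against tolerance and penalty *)

Section StepSize.
Variables (R : realFieldType) (C1 C2 N d h G : R).
Hypotheses (C1_ge1 : 1 <= C1) (C2_ge0 : 0 <= C2) (N_ge0 : 0 <= N) (d_ge0 : 0 <= d)
  (h_gt0 : 0 < h) (G_gt : h ^+ 2 < G) (G_le : G <= C1 * (N ^+ 2 + d * N ^+ 3)).

Lemma step_gt0 : 0 < N.
Proof.
rewrite lt_def N_ge0 andbT; apply/eqP => N0.
have := G_le; rewrite N0 !expr0n /= mulr0 addr0 mulr0 => /(lt_le_trans G_gt).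
by rewrite ltNge sqr_ge0.
Qed.

(** The gradient bound becomes [h ^+ 2 <= q * N ^+ 2]; multiplying by [d ^+ 2] brings in
    [d * N <= C2]. *)
Lemma small_penalty : d * N <= C2 -> d * h <= C1 * (1 + C2) * C2.
Proof.
move=> dN; set q := C1 * (1 + C2).
have a1 := C1_ge1; have a2 := C2_ge0.
have q1 : 1 <= q by rewrite /q; nra.
have N20 : 0 <= N ^+ 2 by rewrite exprn_ge0.
have hN : h ^+ 2 <= q * N ^+ 2.
  have hG := le_trans (ltW G_gt) G_le.
  apply: (le_trans hG).
  rewrite /q -mulrA ler_wpM2l//; first lra.
  rewrite mulrDl mul1r lerD2l exprS mulrA.
  by rewrite ler_wpM2r.
have q0 : 0 <= q by lra.
have qC : 0 <= q * C2 by exact: mulr_ge0.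
have dh0 : 0 <= d * h by rewrite mulr_ge0// ltW.
rewrite -(ler_pXn2r (_ : (0 < 2)%N)) ?nnegrE//.
apply: le_trans (_ : q * (d * N) ^+ 2 <= _).
  by rewrite !exprMn [leRHS]mulrCA; apply: ler_wpM2l => //; rewrite exprn_ge0.
apply: le_trans (_ : q * C2 ^+ 2 <= _).
  by rewrite ler_wpM2l//; apply: lerXn2r; rewrite ?nnegrE ?mulr_ge0.
by rewrite exprMn ler_wpM2r ?exprn_ge0// expr2; nra.
Qed.

(** If [G <= 2 * C1 * N ^+ 2], then [h <= 2 * C1 * N] supplies the third power of [N]. Otherwise [G]
    is at most a multiple of [d * N ^+ 3], and [d * h <= Kd] absorbs [h]. *)
Lemma cubic_step Kd : 1 <= Kd -> d * h <= Kd -> G * h <= 4 * C1 ^+ 2 * Kd * N ^+ 3.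
Proof.
move=> K1 dh; have N0 := step_gt0; have a1 := C1_ge1; have h0 := h_gt0.
have hG := G_gt; have N3 : 0 < N ^+ 3 by rewrite exprn_gt0.
have G0 : 0 < G by apply: le_lt_trans hG; rewrite sqr_ge0.
have CC : C1 <= C1 ^+ 2 by rewrite expr2; nra.
have [big|small] := leP G (2 * C1 * N ^+ 2).
  have hN : h <= 2 * C1 * N.
    rewrite -(ler_pXn2r (_ : (0 < 2)%N)) ?nnegrE ?(ltW h0)//; last by rewrite !mulr_ge0//; lra.
    apply: le_trans (le_trans (ltW hG) big) _; rewrite exprMn ler_wpM2r ?exprn_ge0//.
    by rewrite exprMn; lra.
  apply: le_trans (_ : 2 * C1 * N ^+ 2 * (2 * C1 * N) <= _).
    by apply: ler_pM => //; exact: ltW.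
  rewrite (_ : _ * _ = 4 * C1 ^+ 2 * N ^+ 3); last by ring.
  rewrite ler_wpM2r ?(ltW N3)// ler_peMr//.
  by rewrite mulr_ge0 ?sqr_ge0.
have dN3 : G <= 2 * C1 * (d * N ^+ 3) by have := G_le; rewrite mulrDr; lra.
apply: le_trans (ler_wpM2r (ltW h0) dN3) _.
rewrite (_ : _ * h = 2 * C1 * (d * h * N ^+ 3)); last by ring.
apply: le_trans (_ : 2 * C1 * (Kd * N ^+ 3) <= _).
  by rewrite ler_wpM2l ?mulr_ge0//; [lra|rewrite ler_wpM2r// ltW].
rewrite mulrA ler_wpM2r ?(ltW N3)// ler_wpM2r//; lra.
Qed.
End StepSize.

Section Constants.
Context {R : realType} {n : nat}.
Variables (f0 : R) (g : 'cV[R]_n) (H : 'M[R]_n) (T : tensor3 R n)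
    (sigma : R) (W : 'M[R]_n).
Hypotheses (sH : symmetric_mx H) (sT : symmetric_tensor T) (sigma_gt0 : 0 < sigma)
  (sW : symmetric_mx W) (pW : pos_def W).
Variables (B alpha eta : R).
Hypotheses (B_gt0 : 0 < B) (alpha_gt0 : 0 < alpha) (eta_gt0 : 0 < eta)
  (eta_le1 : eta <= 1).
Local Notation m3 := (ar3_model f0 g H T sigma W).
Local Notation succ := (successful m3 sigma W alpha eta).
Local Notation G x := (norm2 (grad m3 (trial x))).

Lemma iteration_constants : exists C1 C2 : R, [/\ 1 <= C1, 0 <= C2 &
  forall x : iterate R n, admissible f0 g H T sigma W B x -> m3 (it_s x) <= m3 0 ->
    let N := normW W (step x) in
    [/\ G x <= C1 * (N ^+ 2 + it_d x * N ^+ 3),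
        succ x -> m3 (trial x) + eta * (alpha / 20) * N ^+ 3 <= m3 (it_s x)
      & 0 < N -> ~~ succ x -> it_d x * N <= C2]].
Proof.
have [L L0 Lev] := level_set_bounded f0 g H T sigma_gt0 sW pW.
have [K K0 KP] := derivatives_bound H T sigma_gt0 sW pW (ltW L0).
have [Lam Lam0 LP] := normW_le_norm2 W.
have [kW kW0 kP] := normW_bil_bound sW pW W.
have KB : 0 <= (K + B) / 2 by rewrite divr_ge0// addr_ge0// ltW.
exists (1 + ((K + B) / 2 + kW) * Lam), (K + B + alpha); split.
- by rewrite lerDl mulr_ge0// addr_ge0.
- by rewrite !addr_ge0// ltW.
move=> x ax lx N; have [_ third_formP] := KP _ (Lev _ lx).
have N0 : 0 <= N := normW_ge0 _ _; have [_ d0 _ _] := ax.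
split=> [|sx|Ngt].
- apply: le_trans (grad_trial_le sH sT sW pW B_gt0 ax K0 third_formP kW0 Lam0 kP LP) _.
  rewrite -/N; set Y := N ^+ 2 + it_d x * N ^+ 3; set A := (K + B) / 2.
  have Y0 : 0 <= Y by rewrite addr_ge0 ?mulr_ge0 ?exprn_ge0.
  have XY : A * N ^+ 2 + kW * it_d x * N ^+ 3 <= (A + kW) * Y.
    have k2 : 0 <= kW * N ^+ 2 by rewrite mulr_ge0 ?exprn_ge0.
    have a3 : 0 <= A * (it_d x * N ^+ 3) by rewrite mulr_ge0// mulr_ge0// exprn_ge0.
    rewrite -subr_ge0 (_ : _ - _ = kW * N ^+ 2 + A * (it_d x * N ^+ 3)) ?addr_ge0//.
    by rewrite /Y; ring.
  apply: le_trans (ler_wpM2r Lam0 XY) _.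
  by rewrite [leRHS]mulrDl mul1r mulrAC lerDr.
- have := successful_decrease sH sT sigma_gt0 sW pW alpha_gt0 eta_gt0 ax sx.
  by rewrite -/N; lra.
- apply: contraR; rewrite -ltNge => /ltW.
  exact: (large_penalty_successful sH sT sigma_gt0 sW pW B_gt0 alpha_gt0 eta_le1 ax K0 third_formP).
Qed.
End Constants.

(** * Runs of the algorithm *)

Section Run.
Context {R : realType} {n : nat}.
Variables (f0 : R) (g : 'cV[R]_n) (H : 'M[R]_n) (T : tensor3 R n)
    (sigma : R) (W : 'M[R]_n).
Hypotheses (sH : symmetric_mx H) (sT : symmetric_tensor T) (sigma_gt0 : 0 < sigma)
  (sW : symmetric_mx W) (pW : pos_def W).
Variables (B alpha eta gamma : R).
Hypotheses (B_gt0 : 0 < B) (alpha_gt0 : 0 < alpha) (eta_gt0 : 0 < eta)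
  (eta_le1 : eta <= 1) (gamma_gt1 : 1 < gamma).
Local Notation m3 := (ar3_model f0 g H T sigma W).
Local Notation succ := (successful m3 sigma W alpha eta).
Local Notation G x := (norm2 (grad m3 (trial x))).

(* What counting the iterations needs of a run with [eps = h ^+ 2]. *)
Definition regular_run (c K h : R) (r : nat -> iterate R n) (k : nat) :=
  [/\ it_s (r 0%N) = 0, forall i, (i <= k)%N -> 0 <= it_d (r i) /\ it_d (r i) * h <= K,
   forall i, (i < k)%N -> h ^+ 2 < G (r i),
   forall i, (i < k)%N -> succ (r i) ->
     it_s (r i.+1) = trial (r i) /\ m3 (trial (r i)) + c * (G (r i) * h) <= m3 (it_s (r i))
   & forall i, (i < k)%N -> ~~ succ (r i) ->
     it_s (r i.+1) = it_s (r i) /\ it_d (r i.+1) = gamma * Num.max 1 (it_d (r i))].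

Lemma run_regular : exists c K : R, [/\ 0 < c, 0 <= K &
  forall h r, 0 < h -> h <= 1 ->
    is_run m3 sigma W B alpha eta gamma (h ^+ 2) r ->
    tensors_bounded m3 W B (h ^+ 2) r ->
    forall k, reached m3 (h ^+ 2) r k -> regular_run c K h r k].
Proof.
have [C1 [C2 [C11 C20 it]]] :=
  iteration_constants f0 g sH sT sigma_gt0 sW pW B_gt0 alpha_gt0 eta_gt0 eta_le1.
have g1 := gamma_gt1; have g0 : 0 < gamma by lra.
have q0 : 0 <= C1 * (1 + C2) * C2 by rewrite !mulr_ge0//; lra.
(* [small_penalty] bounds [d * h] at a failure; the update of [d] by [gamma] and the maximum with 1,
   with [h <= 1], gives this [K]. *)
pose K := gamma * (1 + C1 * (1 + C2) * C2).
have K1 : 1 <= K by rewrite /K; nra.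
pose Z := 4 * C1 ^+ 2 * K.
have Z0 : 0 < Z by rewrite !mulr_gt0 ?exprn_gt0//; lra.
pose cs := eta * (alpha / 20).
have cs0 : 0 < cs by rewrite mulr_gt0 ?divr_gt0// eta_gt0.
exists (cs / Z), K; split; [exact: divr_gt0|lra|].
move=> h r h0 h1 [s0 d0 runP] bnd k rk.
have reach i : (i <= k)%N -> reached m3 (h ^+ 2) r i.
  by move=> ik j ji; apply: rk; exact: leq_trans ik.
have go i : (i < k)%N -> ~~ stop m3 (h ^+ 2) (r i) by move=> ik; exact: rk.
have adm i : (i < k)%N -> 0 <= it_d (r i) -> admissible f0 g H T sigma W B (r i).
  move=> ik di; have ri := reach i (ltnW ik); have [tr am _] := runP i ri.
  have := go i ik; rewrite negb_or => /andP[ns _]; split=> //; last 1 first.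
  - exact: bnd.
  - case: tr => [[-> _]|[P [a [_ ]]]] //; exact: unitmx1.
  - exact: am.
have Ggt i : (i < k)%N -> h ^+ 2 < G (r i).
  move=> ik; have := go i ik; rewrite /stop negb_or => /andP[_].
  by rewrite /stop_trial -ltNge.
(* The three bounds go together: the step estimates require an iterate in the initial level set, and
   they yield the next penalty bound and the descent. *)
have inv i : (i <= k)%N ->
    [/\ 0 <= it_d (r i), it_d (r i) * h <= K & m3 (it_s (r i)) <= m3 0].
  elim: i => [_|i IH ik]; first by rewrite s0 d0 mul0r; split=> //; lra.
  have [di dh mi] := IH (ltnW ik).
  have [_ _ /(_ (go i ik)) up] := runP i (reach i (ltnW ik)).
  have [Gi si ui] := it _ (adm i ik di) mi.
  set N := normW W _ in Gi si ui.
  have N0 : 0 <= N := normW_ge0 _ _.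
  move: up; rewrite /update; case: ifPn => sc.
    move=> [-> /andP[d'0 d'd]]; split=> //.
      by apply: le_trans dh; rewrite ler_wpM2r// ltW.
    apply: le_trans mi; apply: le_trans (si sc); rewrite lerDl.
    by rewrite mulr_ge0 ?exprn_ge0 ?(ltW cs0).
  move=> [-> -> _ _]; split=> //.
    by rewrite mulr_ge0 ?(ltW g0)// le_max ler01.
  have Np := step_gt0 N0 (Ggt i ik) Gi.
  have dNh := small_penalty C11 C20 N0 di h0 (Ggt i ik) Gi (ui Np sc).
  rewrite /K -mulrA ler_wpM2l ?(ltW g0)// maxEle.
  case: ifP => _; first by apply: le_trans dNh _; rewrite lerDr ler01.
  by rewrite mul1r (le_trans h1)// lerDl.
split=> //.
- by move=> i /inv[].
- move=> i ik sc; have [di dh mi] := inv i (ltnW ik).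
  have [_ _ /(_ (go i ik)) up] := runP i (reach i (ltnW ik)).
  have [Gi si ui] := it _ (adm i ik di) mi.
  set N := normW W _ in Gi si ui; have N0 : 0 <= N := normW_ge0 _ _.
  move: up; rewrite /update sc => -[sE _]; split=> //.
  apply: le_trans (si sc); rewrite lerD2l -/cs mulrAC ler_pdivrMr//.
  rewrite -[leRHS]mulrA; apply: ler_wpM2l; first exact: ltW.
  rewrite [leRHS]mulrC.
  exact: (cubic_step C11 N0 h0 (Ggt i ik) Gi K1 dh).
- move=> i ik sc; have [_ _ /(_ (go i ik)) up] := runP i (reach i (ltnW ik)).
  by move: up; rewrite /update (negPf sc) => -[].
Qed.

Section RegularRun.
Variables (c K h : R) (r : nat -> iterate R n) (k : nat).
Hypotheses (c_gt0 : 0 < c) (K_ge0 : 0 <= K) (h_gt0 : 0 < h) (h_le1 : h <= 1)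
  (reg : regular_run c K h r k).

Let S i := (\sum_(j < i) succ (r j))%N.

(* After [t] consecutive failures [gamma ^ t <= d <= K / h], whence [t = O(1 / h)]
   by Bernoulli's inequality. *)
Lemma iterations_le_successes :
  exists2 U : nat, U%:R * h <= K / (gamma - 1) &
    (k.+1 <= (S k).+1 * U.+1)%N.
Proof.
have [s0 dK _ sP uP] := reg; have g1 := gamma_gt1; have h0 := h_gt0; have K0 := K_ge0.
have U0 : 0 <= K / ((gamma - 1) * h).
  by rewrite divr_ge0// mulr_ge0//; lra.
have /andP[U1 U2] := truncn_itv U0; set U := Num.truncn _ in U1 U2.
exists U.
  move: U1; rewrite invfM mulrA ler_pdivlMr//.
have bern t : 1 + t%:R * (gamma - 1) <= gamma ^+ t.
  elim: t => [|t IH]; first by rewrite mul0r addr0 expr0.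
  rewrite exprS -addn1 natrD mulrDl mul1r.
  have : 0 <= t%:R * (gamma - 1) ^+ 2 by rewrite mulr_ge0 ?sqr_ge0.
  have : gamma * (1 + t%:R * (gamma - 1)) <= gamma * gamma ^+ t by rewrite ler_wpM2l//; lra.
  by rewrite expr2; nra.
have tU i t : (i <= k)%N -> t = 0%N \/ gamma ^+ t <= it_d (r i) -> (t <= U)%N.
  move=> ik [->//|td]; rewrite -ltnS -(ltr_nat R); apply: le_lt_trans U2.
  rewrite ler_pdivlMr ?mulr_gt0 ?subr_gt0//; have [_ dh] := dK i ik.
  apply: le_trans dh; rewrite mulrA ler_wpM2r ?(ltW h0)//; apply: le_trans td.
  by apply: le_trans (bern t); rewrite lerDr.
have main i : (i <= k)%N -> exists2 t,
    t = 0%N \/ gamma ^+ t <= it_d (r i) & (i <= S i * U.+1 + t)%N.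
  elim: i => [_|i IH ik]; first by exists 0%N; [left|].
  have [t td it] := IH (ltnW ik); have tu := tU i t (ltnW ik) td.
  rewrite /S big_ord_recr /= -/(S i); have [sc|sc] := boolP (succ (r i)).
    exists 0%N; [by left|].
    by rewrite addn0 mulnDl mul1n addnS ltnS (leq_trans it)// leq_add2l.
  have [_ dE] := uP i ik sc; exists t.+1; last by rewrite addn0 addnS ltnS.
  right; rewrite dE exprS; apply: ler_wpM2l; first lra.
  by case: td => [t0|td]; rewrite le_max ?t0 ?lexx// td orbT.
have [t td it] := main k (leqnn k); have tu := tU k t (leqnn k) td.
by rewrite mulSn addSn ltnS addnC (leq_trans it)// leq_add2l.
Qed.

Lemma m3_decreasing i j : (i <= j <= k)%N -> m3 (it_s (r j)) <= m3 (it_s (r i)).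
Proof.
have [_ _ GP sP uP] := reg; move=> /andP[ij jk].
elim: j ij jk => [|j IH]; first by rewrite leqn0 => /eqP ->.
rewrite leq_eqVlt => /predU1P[->//|]; rewrite ltnS => ij jk.
apply: le_trans (IH ij (ltnW jk)); have [sc|sc] := boolP (succ (r j)).
  have [-> ] := sP j jk sc; apply: le_trans; rewrite lerDl.
  by rewrite !mulr_ge0 ?norm2_ge0// ltW.
by have [-> _] := uP j jk sc.
Qed.

(** Two counts are needed: successes with gradient above [h] at weight [p = h ^+ 2], and all
    successes at weight [p = h ^+ 3]. *)
Lemma weighted_successes (P : pred (iterate R n)) p :
  (forall i, (i < k)%N -> P (r i) -> succ (r i) /\ p <= G (r i) * h) ->
  m3 (it_s (r k)) + c * p * (\sum_(j < k) P (r j))%:R <= m3 0.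
Proof.
have [s0 _ GP sP uP] := reg => PP.
suff H' i : (i <= k)%N -> m3 (it_s (r i)) + c * p * (\sum_(j < i) P (r j))%:R <= m3 0.
  exact: H'.
elim: i => [_|i IH ik]; first by rewrite big_ord0 s0 mulr0 addr0.
apply: le_trans (IH (ltnW ik)); rewrite big_ord_recr /= natrD mulrDr.
rewrite (addrC (_ * _)) addrA lerD2r.
case: (boolP (P (r i))) => [/(PP i ik)[sc pG]|_]; last first.
  by rewrite mulr0 addr0; apply: m3_decreasing; rewrite leqnSn.
have [-> dec] := sP i ik sc; apply: le_trans dec.
by rewrite mulr1 lerD2l ler_wpM2l// ltW.
Qed.

End RegularRun.

Variable m_low : R.
Hypothesis m_low_le : forall s, m_low <= m3 s.

Lemma successes_le c K : 0 < c -> exists Q : R, forall h r k, 0 < h -> h <= 1 ->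
  regular_run c K h r k -> (\sum_(j < k) succ (r j)).+1%:R * h ^+ 2 <= Q.
Proof.
move=> c0; have [M M0 few] := few_low_gradient_values f0 g sH sT sigma_gt0 sW pW c0.
(* [M + 1] is for the successes of low gradient, one more than the gaps between them; the other 1 is
   for the [.+1]. *)
exists (M + 2 + (m3 0 - m_low) / c) => h r k h0 h1 reg.
pose low x := succ x && (G x <= h); pose high x := succ x && (h < G x).
have [_ _ GP sP _] := reg.
have -> : (\sum_(j < k) succ (r j) = \sum_(j < k) low (r j) + \sum_(j < k) high (r j))%N.
  rewrite -big_split /=; apply: eq_bigr => j _; rewrite /low /high leNgt.
  by case: (succ _); case: (h < _).
have h2 : h ^+ 2 <= 1 by apply: exprn_ile1 => //; exact: ltW.
have Hhigh : (\sum_(j < k) high (r j))%:R * h ^+ 2 <= (m3 0 - m_low) / c.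
  have wh : m3 (it_s (r k)) + c * h ^+ 2 * (\sum_(j < k) high (r j))%:R <= m3 0.
    apply: (weighted_successes c0 h0 reg) => i ik /andP[sc hG]; split=> //.
    by rewrite expr2 ler_wpM2r// ltW.
  rewrite ler_pdivlMr// (_ : _ * c = c * h ^+ 2 * (\sum_(j < k) high (r j))%:R); last by ring.
  by have := m_low_le (it_s (r k)); lra.
have Hlow : (\sum_(j < k) low (r j))%:R * h ^+ 2 <= M + 1.
  pose l := [seq j <- iota 0 k | low (r j)].
  have lE : (\sum_(j < k) low (r j))%N = size l.
    rewrite -(big_mkord xpredT (fun j => nat_of_bool (low (r j)))) /index_iota subn0.
    rewrite size_filter -sum1_count [RHS]big_mkcond.
    by apply: eq_bigr => j _; case: ifP.
  have ls : sorted ltn l by apply: sorted_filter; [exact: ltn_trans|exact: iota_ltn_sorted].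
  pose i j := nth 0%N l j; pose x j := trial (r (i j)).
  have lP j : (j < size l)%N -> [/\ (i j < k)%N, succ (r (i j)) & G (r (i j)) <= h].
    by move=> /(mem_nth 0%N); rewrite mem_filter mem_iota add0n => /andP[/andP[? ?] ?].
  rewrite lE; case E : (size l) => [|N]; first by rewrite mul0r; lra.
  (* The value at a trial point is at least the value from which the next listed success starts, and
     that success loses at least [c * h ^+ 3]. *)
  have gap : N%:R * h ^+ 2 <= M.
    apply: (few h N x h0 h1) => [j jN|j jN].
      have jl : (j < size l)%N by rewrite E.
      have [ik sc Gh] := lP j jl.
      split=> //; rewrite /x; have [<- _] := sP _ ik sc.
      have [s0 _ _ _ _] := reg; rewrite -s0.
      by apply: (m3_decreasing c0 h0 reg).
    have jl' : (j.+1 < size l)%N by rewrite E.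
    have jl := ltnW jl'; have [ik sc _] := lP j jl; have [ik' sc' _] := lP j.+1 jl'.
    have ii : (i j < i j.+1)%N.
      by apply: (sorted_ltn_nth ltn_trans 0%N ls); rewrite ?inE.
    have [sE _] := sP _ ik sc; have [_ dec] := sP _ ik' sc'.
    have mono : m3 (it_s (r (i j.+1))) <= m3 (it_s (r (i j).+1)).
      by apply: (m3_decreasing c0 h0 reg); rewrite ii ltnW.
    rewrite /x -sE; apply: le_trans mono; apply: le_trans dec; rewrite lerD2l.
    rewrite ler_wpM2l ?(ltW c0)// exprSr ler_wpM2r ?(ltW h0)// ltW//.
    exact: GP.
  by rewrite -addn1 natrD mulrDl mul1r; lra.
rewrite -natr1 natrD 2![in leLHS]mulrDl mul1r.
move: Hhigh; set X := (_ / c); move: X => X Hhigh; lra.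
Qed.

Lemma run_complexity : exists c Q : R, [/\ 0 < c, 0 < Q &
  forall h r, 0 < h -> h <= 1 ->
    is_run m3 sigma W B alpha eta gamma (h ^+ 2) r ->
    tensors_bounded m3 W B (h ^+ 2) r ->
    exists k, [/\ terminates_at m3 (h ^+ 2) r k, k.+1%:R * h ^+ 3 <= Q &
      (\sum_(j < k) succ (r j))%:R * (c * h ^+ 3) <= m3 0 - m_low]].
Proof.
have [c [K [c0 K0 regP]]] := run_regular.
have [Q QP] := successes_le K c0.
have g1 := gamma_gt1.
pose V := K / (gamma - 1) + 1.
have V0 : 0 < V by rewrite ltr_wpDl// divr_ge0//; lra.
exists c, (1 + `|Q| * V); split=> //.
  by rewrite ltr_pwDl// mulr_ge0// ltW.
move=> h r h0 h1 run bnd.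
have count k : reached m3 (h ^+ 2) r k -> k.+1%:R * h ^+ 3 <= 1 + `|Q| * V.
  move=> rk; have reg := regP h r h0 h1 run bnd k rk.
  have [U UK kU] := iterations_le_successes K0 h0 reg.
  apply: le_trans (_ : Q * V <= _); last first.
    by apply: le_trans (_ : `|Q| * V <= _); [rewrite ler_wpM2r ?ler_norm// ltW|rewrite lerDr].
  apply: le_trans (_ : (\sum_(j < k) succ (r j)).+1%:R * h ^+ 2 * (U.+1%:R * h) <= _).
    rewrite [leRHS](_ : _ = ((\sum_(j < k) succ (r j)).+1 * U.+1)%:R * h ^+ 3); last by rewrite natrM; ring.
    by rewrite ler_wpM2r ?ler_nat// exprn_ge0// ltW.
  apply: ler_pM; rewrite ?mulr_ge0 ?exprn_ge0 ?ler0n ?(ltW h0)//.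
    exact: QP reg.
  by rewrite -addn1 natrD mulrDl mul1r lerD.
(* [count] bounds every index that is reached, and a run without stopping would reach all of
   them. *)
have [k rk] : exists k, stop m3 (h ^+ 2) (r k).
  apply/not_existsP => nostop.
  have all_reached k : reached m3 (h ^+ 2) r k by move=> j _; apply/negP; exact: nostop.
  have h3 : 0 < h ^+ 3 by rewrite exprn_gt0.
  have p0 : 0 <= (1 + `|Q| * V) / h ^+ 3 by rewrite divr_ge0 ?(ltW h3)// addr_ge0// mulr_ge0// ltW.
  have /andP[_ k2] := truncn_itv p0.
  have := count _ (all_reached (Num.truncn ((1 + `|Q| * V) / h ^+ 3))).
  by rewrite -ler_pdivlMr// leNgt k2.
have [i si imin] := ex_minnP (ex_intro (fun k => stop m3 (h ^+ 2) (r k)) k rk).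
have ri : reached m3 (h ^+ 2) r i.
  by move=> j ji; apply/negP => /imin; rewrite leqNgt ji.
exists i; split=> //; first exact: count.
have reg := regP h r h0 h1 run bnd i ri; have [_ _ GP _ _] := reg.
have wh : m3 (it_s (r i)) + c * h ^+ 3 * (\sum_(j < i) succ (r j))%:R <= m3 0.
  apply: (weighted_successes c0 h0 reg) => j ji sc; split=> //.
  by rewrite exprSr ler_wpM2r ?(ltW h0)// ltW// GP.
by rewrite mulrC; have := m_low_le (it_s (r i)); lra.
Qed.
End Run.

(** * From iteration counts to evaluation bounds *)

Lemma evals_le_double (k : nat) (b : bool) : (1 + k + b <= 2 * k.+1)%N.
Proof. by case: b; lia. Qed.

Lemma powR_neg_half (R : realType) (x : R) : 0 <= x ->
  x `^ (- (1 / 2)) = (Num.sqrt x)^-1.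
Proof. by move=> x0; rewrite powRN div1r powR12_sqrt. Qed.

Lemma bigO_three_halves (R : realType) (f : R -> R) (a : R) :
  (forall e, 0 < e -> e <= 1 -> `|f e| <= a * e `^ (- (3 / 2))) ->
  (f : R -> R^o) =O_ (0^'+) (fun e : R => e `^ (- (3 / 2)) : R^o).
Proof.
move=> fa; apply/eqOP; near=> k; near=> e.
have e0 : 0 < e by near: e; exact: nbhs_right_gt.
have e1 : e <= 1 by near: e; exact: nbhs_right_le.
apply: le_trans (fa e e0 e1) _.
rewrite [X in _ <= _ * X]ger0_norm; last exact: powR_ge0.
apply: ler_wpM2r; first exact: powR_ge0.
by near: k; apply: nbhs_pinfty_ge; exact: num_real.
Unshelve. all: by end_near.
Qed.

Theorem theorem5p2 (R : realType) (n : nat)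
    (f0 : R) (g : 'cV[R]_n) (H : 'M[R]_n) (T : tensor3 R n)
    (sigma : R) (W : 'M[R]_n)
    (H_sym : symmetric_mx H) (T_sym : symmetric_tensor T)
    (sigma_gt0 : 0 < sigma) (W_sym : symmetric_mx W) (W_pos : pos_def W)
    (m_low : R)
    (m_low_le : forall s : 'cV[R]_n, m_low <= ar3_model f0 g H T sigma W s)
    (B alpha eta gamma : R)
    (B_gt0 : 0 < B) (alpha_gt0 : 0 < alpha) (alpha_lt : alpha < 1 / 2)
    (eta_gt0 : 0 < eta) (eta_le1 : eta <= 1) (gamma_gt1 : 1 < gamma) :
  let m3 := ar3_model f0 g H T sigma W in
  exists kappa_s kappa_c : R,
    let function_bound (eps : R) : R :=
      kappa_s * ((m3 0 - m_low) / eps `^ (3 / 2)) + kappa_c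
        + ln (eps `^ (- (1 / 2))) in
    let derivative_bound (eps : R) : R :=
      kappa_s * ((m3 0 - m_low) / eps `^ (3 / 2)) + 1 in
    [/\ 0 < kappa_s,
        0 < kappa_c,
        forall (eps : R) (r : nat -> iterate R n),
          0 < eps -> eps <= 1 ->
          is_run m3 sigma W B alpha eta gamma eps r ->
          tensors_bounded m3 W B eps r ->
          exists k : nat,
            [/\ terminates_at m3 eps r k,
                norm2 (grad m3 (output m3 eps (r k))) <= eps,
                (function_evals m3 eps r k)%:R <= function_bound eps
              & (derivative_evals m3 sigma W alpha eta r k)%:R
                  <= derivative_bound eps],
        (function_bound : R -> R^o) =O_ (0^'+)
          (fun eps : R => eps `^ (- (3 / 2)) : R^o)
      & (derivative_bound : R -> R^o) =O_ (0^'+)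
          (fun eps : R => eps `^ (- (3 / 2)) : R^o)].
Proof.
move=> m3; set Delta := m3 0 - m_low.
have D0 : 0 <= Delta by rewrite subr_ge0; exact: m_low_le.
have [c [Q [c0 Q0 runP]]] := run_complexity H_sym T_sym sigma_gt0 W_sym W_pos
  B_gt0 alpha_gt0 eta_gt0 eta_le1 gamma_gt1 m_low_le.
(* When [Delta = 0] the starting point is a global minimizer and the run stops at
   once; otherwise [ks * Delta] can absorb any constant. *)
pose ks := if Delta == 0 then 1 else 2 * Q / Delta + c^-1.
have ks0 : 0 < ks.
  rewrite /ks; case: eqP => // /eqP D_neq0.
  by rewrite addr_gt0 ?invr_gt0// divr_gt0 ?mulr_gt0// lt_def D_neq0.
have ksD : 0 <= ks * Delta by rewrite mulr_ge0// ltW.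
have sqrt_facts (e : R) : 0 < e -> e <= 1 ->
    [/\ 0 < Num.sqrt e, Num.sqrt e <= 1, Num.sqrt e ^+ 2 = e,
        1 <= (Num.sqrt e)^-1 & 1 <= (Num.sqrt e)^-1 ^+ 3].
  move=> e0 e1; have s0 : 0 < Num.sqrt e by rewrite sqrtr_gt0.
  have s1 : Num.sqrt e <= 1 by rewrite -sqrtr1 ler_wsqrtr.
  have si : 1 <= (Num.sqrt e)^-1 by rewrite invf_ge1.
  by rewrite sqr_sqrtr ?(ltW e0)//; split=> //; exact: exprn_ege1.
(* The 2 covers the single evaluation made when [Delta = 0]. *)
exists ks, 2 => function_bound derivative_bound.
have boundE e : 0 < e -> ks * (Delta / e `^ (3 / 2)) = ks * Delta * (Num.sqrt e)^-1 ^+ 3.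
  by move=> e0; rewrite powR_three_halves ?(ltW e0)// exprVn mulrA.
split=> //; last 2 first.
- apply: (@bigO_three_halves _ _ (ks * Delta + 3)) => e e0 e1.
  have [s0 s1 _ si s3] := sqrt_facts e e0 e1.
  rewrite /function_bound boundE// powR_neg_half ?(ltW e0)//.
  rewrite powRN powR_three_halves ?(ltW e0)// -exprVn; set u := (Num.sqrt e)^-1 in si s3 *.
  have l0 : 0 <= ln u by exact: ln_ge0.
  have lu : ln u <= u by apply/ltW/ln_sublinear; lra.
  have u3 : u <= u ^+ 3 by rewrite ler_eXnr.
  have p0 : 0 <= ks * Delta * u ^+ 3 by rewrite mulr_ge0//; lra.
  by rewrite ger0_norm; lra.
- apply: (@bigO_three_halves _ _ (ks * Delta + 1)) => e e0 e1.
  have [s0 s1 _ si s3] := sqrt_facts e e0 e1.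
  rewrite /derivative_bound boundE// powRN powR_three_halves ?(ltW e0)// -exprVn.
  set u := (Num.sqrt e)^-1 in si s3 *.
  have p0 : 0 <= ks * Delta * u ^+ 3 by rewrite mulr_ge0//; lra.
  by rewrite ger0_norm; lra.
move=> eps r e0 e1 run bnd; have [h0 h1 hE hi h3] := sqrt_facts eps e0 e1.
have out k : terminates_at m3 eps r k -> norm2 (grad m3 (output m3 eps (r k))) <= eps.
  move=> [_]; rewrite /stop /output; case: ifPn => [//|_] /=.
  by [].
have ln0 : 0 <= ln (eps `^ (- (1 / 2))) by rewrite powR_neg_half ?(ltW e0)// ln_ge0.
have [Dz|Dnz] := eqVneq Delta 0.
  have st : stop_start m3 eps (r 0%N).
    have [s00 _ _] := run; rewrite /stop_start s00; apply: le_trans (ltW e0).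
    apply: norm2_grad_le => // v; rewrite mul0r normr_le0; apply/eqP.
    apply: (@linear_coef0 _ _ (hess_form H T sigma W 0 v v / 2) (third_form T sigma W 0 v v v / 6)
      (sigma / 4 * bil W v v ^+ 2)) => h.
    have := m_low_le (h *: v + 0); rewrite model_line// -subr_ge0.
    have -> : m_low = m3 0 by apply/esym/subr0_eq.
    by congr (0 <= _); rewrite /m3; ring.
  have t0 : terminates_at m3 eps r 0 by split=> //; rewrite /stop st.
  exists 0%N; split; [exact: t0|exact: out| |].
    rewrite /function_evals st /function_bound Dz mul0r mulr0 add0r.
    by rewrite [leLHS](_ : _ = 1) //; lra.
  by rewrite /derivative_evals big_ord0 addn0 /derivative_bound Dz mul0r mulr0 add0r.
have Dp : 0 < Delta by rewrite lt_def Dnz.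
rewrite -{1}hE in run; rewrite -{1}hE in bnd.
have [k [tk kQ Sk]] := runP _ r h0 h1 run bnd; rewrite hE in tk.
(* [2 * Q] pays for the at most [2 * k.+1] function evaluations, [Delta / c] for the successful
   steps. *)
have kE : ks * Delta = 2 * Q + Delta / c.
  by rewrite /ks (negPf Dnz); field; rewrite !gt_eqF.
have u3 : 0 < Num.sqrt eps ^+ 3 by rewrite exprn_gt0.
have Dc0 : 0 <= Delta / c * (Num.sqrt eps)^-1 ^+ 3.
  by rewrite mulr_ge0 ?divr_ge0 ?(ltW c0)// (le_trans ler01).
have Qu : k.+1%:R <= Q * (Num.sqrt eps)^-1 ^+ 3 by rewrite exprVn ler_pdivlMr.
exists k; split; [exact: tk|exact: out| |].
  rewrite /function_bound boundE// kE mulrDl.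
  have : (function_evals m3 eps r k)%:R <= 2 * k.+1%:R :> R.
    by rewrite -natrM ler_nat; exact: evals_le_double.
  move: Qu; rewrite -[2 * Q * _]mulrA; lra.
have Sc : (\sum_(j < k) successful m3 sigma W alpha eta (r j))%:R <=
    Delta / c * (Num.sqrt eps)^-1 ^+ 3.
  rewrite exprVn -mulrA -invfM ler_pdivlMr; first exact: Sk.
  by rewrite mulr_gt0.
rewrite /derivative_bound boundE// kE mulrDl /derivative_evals natrD.
have : 0 <= 2 * Q * (Num.sqrt eps)^-1 ^+ 3.
  by rewrite mulr_ge0 ?mulr_ge0 ?(ltW Q0)// (le_trans ler01).
by move: Sc; lra.
Qed.
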